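(* Let $Q$ be a conjunctive query over a vocabulary $\sigma$ that has no self-joins and is constant-disjoint, and let $\mathcal{K}$ be a semiring such that the subsemiring generated by $\mathbb{0}_{\mathcal{K}}$ and $\mathbb{1}_{\mathcal{K}}$ is zero-sum free. If $\mathrm{DynEval}_{\mathcal{K}}(Q,\sigma)$ can be solved with constant-time updates and constant delay, then $Q$ is q-hierarchical, unless the Online Boolean Matrix-Vector Multiplication (OMv) conjecture is false.
   Context: $\mathcal{K}=(K,\oplus,\odot,\mathbb{0},\mathbb{1})$ is a commutative semiring with $\mathbb{0}\neq\mathbb{1}$; zero-sum free means $a\oplus b=\mathbb{0}$ implies $a=b=\mathbb{0}$. Databases map relation symbols to $K$-relations (functions $(\mathbb{N}_{>0})^a\to K$ with finite support) and constants to positive integers ($1^{db}=1$). A CQ is $H(\bar x)\leftarrow\exists\bar y.a_1\wedge\dots\wedge a_n$ with relational atoms and comparison atoms $x\le c$ under semiring semantics ($x\le c\mapsto\mathbb{1}$ iff $\nu(x)\le c^{db}$ else $\mathbb{0}$); output $H(\bar d)$ = value on $\bar x\mapsto\bar d$ if $\bar d$ respects repetitions, else $\mathbb{0}$. No self-joins: no relation symbol occurs in two atoms. A comparison atom $x\le c$ is covered if some relational atom mentions $x$. Constant-disjoint: every covered $x\le c$ has $c\neq1$, and for every covered $x\le c$ and non-covered $y\le d$ with $c=d$, $y$ is not free in $Q$. With $\mathrm{atoms}(x)$ the set of relational atoms mentioning $x$, $Q$ is q-hierarchical if for all variables $x,y$: $\mathrm{atoms}(x),\mathrm{atoms}(y)$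 are comparable by inclusion or disjoint, and if $x$ is free and $\mathrm{atoms}(x)\subsetneq\mathrm{atoms}(y)$ then $y$ is free. $\mathrm{DynEval}_{\mathcal{K}}(Q,\sigma)$: enumerate without repetition the pairs $(\bar d,[\![Q]\!](db)(H)(\bar d))$ with non-$\mathbb{0}$ value, under single-tuple updates $\mathrm{insert}(R,\bar d,k)$ (set $R(\bar d)$ to $R(\bar d)\oplus k$) and $\mathrm{delete}(R,\bar d)$ (set $R(\bar d)$ to $\mathbb{0}$). Solved with constant-time updates and constant delay: $O(|db|)$ preprocessing ($|db|$ = number of non-$\mathbb{0}$ tuples), $O(1)$ enumeration delay, and each update processed in $O(1)$ time after which enumeration of the new result again has $O(1)$ delay; data complexity on a RAM with uniform cost, semiring operations $O(1)$. OMv conjecture: given an $n\times n$ Boolean matrix $A$ and then $n$ Boolean vectors $v_1,\dots,v_n$ arriving online (each $v_i$ revealed only after $Av_{i-1}$ is output), computing all products $Av_i$ cannot be done in time $O(n^{3-\varepsilon})$ for any $\varepsilon>0$.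
   Formalization: The q-hierarchical conditions are required only for variables mentioned in some relational atom; with free uncovered x included the claim fails, e.g. for H(x) ← ∃y. R(y) ∧ x ≤ c over the Booleans, which is solvable with constant-time updates and constant delay. *)

(* Defs.v *)
From HB Require Import structures.
From mathcomp Require Import all_boot all_order all_algebra.
From mathcomp Require Import finmap.
From mathcomp Require Import all_classical all_reals.
From mathcomp Require Import exp.

Set Implicit Arguments.
Unset Strict Implicit.
Unset Printing Implicit Defensive.

Import Order.TTheory GRing.Theory Num.Theory.

Local Open Scope ring_scope.

Notation pnat := {n : nat | (0 < n)%N}.

(** * Vocabularies, databases, conjunctive queries *)

(* [cst1] is the constant symbol 1. *)
Record vocabulary := Vocabulary {
  rel : finType;
  arity : rel -> nat;
  cst : finType;
  cst1 : cst }.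

Notation fact sg := {r : rel sg & (arity r).-tuple pnat}.

(* The family of K-relations of a database is stored uncurried, as one finitely
   supported function on the facts R(d); as there are finitely many relation
   symbols this amounts to one finitely supported function per symbol. *)
Record database (K : comNzSemiRingType) (sg : vocabulary) := Database {
  db_rel : {fsfun fact sg -> K with 0};
  db_cst : cst sg -> pnat;
  db_cst1 : val (db_cst (cst1 sg)) = 1%N }.

Definition db_size K sg (D : database K sg) : nat := #|` finsupp (db_rel D)|.

Notation ratom sg V := {r : rel sg & (arity r).-tuple V}.

(* H(x) <- exists y. a_1 /\ ... /\ a_n : [cq_head] is the tuple x, [cq_rels] and
   [cq_cmps] list the relational atoms and the comparison atoms (x <= c is the
   pair (x, c)), and V is the set of variables of the body.  The variables in
   the head are free, all the others are quantified. *)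
Record cq (sg : vocabulary) (V : finType) := CQ {
  cq_head : seq V;
  cq_rels : seq (ratom sg V);
  cq_cmps : seq (V * cst sg);
  cq_vars : forall x : V,
    (exists2 a : ratom sg V, a \in cq_rels & x \in tagged a) \/
    (exists c : cst sg, (x, c) \in cq_cmps) }.

Section Queries.
Variables (sg : vocabulary) (V : finType) (Q : cq sg V).

Definition free (x : V) : bool := x \in cq_head Q.

Definition no_self_joins : bool := uniq [seq tag a | a <- cq_rels Q].

Definition atoms_of (x : V) : {set ratom sg V} :=
  [set a in cq_rels Q | x \in tagged a].

Definition covered (x : V) : bool := atoms_of x != finset.set0.

Definition constant_disjoint : Prop :=
  (forall x c, (x, c) \in cq_cmps Q -> covered x -> c <> cst1 sg) /\
  (forall x y c d, (x, c) \in cq_cmps Q -> covered x ->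
     (y, d) \in cq_cmps Q -> ~~ covered y -> c = d -> ~~ free y).

(* x and y range over the variables of the relational atoms.  For a variable
   with [atoms_of x = set0] the first condition is void.  The second one is not
   meant for such variables: it would exclude H(x) <- exists y. R(y) /\ x <= c,
   which over the Boolean semiring only requires counting the tuples of R. *)
Definition q_hierarchical : Prop :=
  forall x y : V, covered x -> covered y ->
  [\/ atoms_of x \subset atoms_of y, atoms_of y \subset atoms_of x
    | [disjoint atoms_of x & atoms_of y]] /\
  (free x -> atoms_of x \proper atoms_of y -> free y).

Section Semantics.
Variables (K : comNzSemiRingType) (D : database K sg).

Definition eval_ratom (nu : {ffun V -> pnat}) (a : ratom sg V) : K :=
  db_rel D (Tagged (fun r : rel sg => (arity r).-tuple pnat)
                   (map_tuple nu (tagged a))).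

Definition eval_cmp (nu : {ffun V -> pnat}) (p : V * cst sg) : K :=
  if (val (nu p.1) <= val (db_cst D p.2))%N then 1 else 0.

Definition eval_body (nu : {ffun V -> pnat}) : K :=
  (\prod_(a <- cq_rels Q) eval_ratom nu a) *
  \prod_(p <- cq_cmps Q) eval_cmp nu p.

(* The sum over the values of the quantified variables is a sum over all the
   valuations that map the head to d.  Only finitely many terms are nonzero,
   and there is none if d does not respect the repetitions in the head. *)
Definition query_value (d : (size (cq_head Q)).-tuple pnat) : K :=
  \sum_(nu \in [set nu : {ffun V -> pnat} |
                 [seq nu x | x <- cq_head Q] = d :> seq pnat]%classic)
    eval_body nu.

End Semantics.
End Queries.

Inductive update (K : Type) (sg : vocabulary) :=
| Insert of fact sg & K
| Delete of fact sg.
Arguments Delete {K sg} _.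

Definition apply_update (K : comNzSemiRingType) sg (u : update K sg) (D : database K sg) :
    database K sg :=
  match u with
  | Insert f k =>
      Database [fsfun db_rel D with f |-> db_rel D f + k] (db_cst1 D)
  | Delete f => Database [fsfun db_rel D with f |-> 0] (db_cst1 D)
  end.

Inductive gen01 (K : comNzSemiRingType) : K -> Prop :=
| gen01_0 : gen01 0
| gen01_1 : gen01 1
| gen01_D a b : gen01 a -> gen01 b -> gen01 (a + b)
| gen01_M a b : gen01 a -> gen01 b -> gen01 (a * b).

Definition gen01_zero_sum_free (K : comNzSemiRingType) : Prop :=
  forall a b : K, gen01 a -> gen01 b -> a + b = 0 -> a = 0 /\ b = 0.

(** * Random access machines with uniform cost

    The memory consists of banks of word registers W_b[i] and of banks of
    semiring registers S_b[i] (a program mentions finitely many banks, so that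
    one could as well interleave them in a single sequence).  A semiring
    register can be added, multiplied, set to 0 or 1, and tested for 0.

    Words are bounded by a parameter M, and a step that would write a larger
    word is stuck: with unbounded words, uniform cost would allow one to handle a
    whole row of a matrix in one step.  Algorithms are required to run with an
    M that is polynomial in the size of the input and in the numbers occurring
    in it, that is, with words of logarithmic length. *)

(* Dir b i is the register i of bank b, and Ind b b' i' is the register
   W_b'[i'] of bank b. *)
Inductive loc := Dir of nat & nat | Ind of nat & nat & nat.

Inductive wop := Add | Sub | Mul | Div | And | Or.

Definition wop_fun (o : wop) : nat -> nat -> nat :=
  match o with
  | Add => addn | Sub => subn | Mul => muln | Div => divn
  | And => Nat.land | Or => Nat.lor
  end.

Inductive instr :=
| WConst of loc & nat
| WOp of wop & loc & loc & loc
| WJz of loc & nat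
| Jmp of nat
| SConst of loc & bool
| SAdd of loc & loc & loc
| SMul of loc & loc & loc
| SJz of loc & nat.

Definition program := seq instr.

Definition word_instr (i : instr) : bool :=
  match i with
  | WConst _ _ | WOp _ _ _ _ | WJz _ _ | Jmp _ => true
  | _ => false
  end.

Section Machine.
Variable K : comNzSemiRingType.

Record memory := Memory {
  wmem : nat -> nat -> nat;
  smem : nat -> nat -> K }.

Definition memory0 : memory := Memory (fun _ _ => 0%N) (fun _ _ => 0).

Definition address (m : memory) (l : loc) : nat * nat :=
  match l with
  | Dir b i => (b, i)
  | Ind b b' i' => (b, wmem m b' i')
  end.

Definition wget (m : memory) (l : loc) : nat :=
  wmem m (address m l).1 (address m l).2.

Definition sget (m : memory) (l : loc) : K :=
  smem m (address m l).1 (address m l).2.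

Definition wset (m : memory) (l : loc) (v : nat) : memory :=
  Memory (fun b i => if (b, i) == address m l then v else wmem m b i) (smem m).

Definition sset (m : memory) (l : loc) (v : K) : memory :=
  Memory (wmem m) (fun b i => if (b, i) == address m l then v else smem m b i).

(* A configuration is a program counter and a memory; the program halts when
   the counter leaves the program. *)
Definition step (M : nat) (P : program) (c : nat * memory) :
    option (nat * memory) :=
  let: (pc, m) := c in
  match onth P pc with
  | None => None
  | Some (WConst l v) =>
      if (v <= M)%N then Some (pc.+1, wset m l v) else None
  | Some (WOp o l l1 l2) =>
      let v := wop_fun o (wget m l1) (wget m l2) in
      if (v <= M)%N then Some (pc.+1, wset m l v) else None
  | Some (WJz l q) => Some (if wget m l == 0%N then q else pc.+1, m)
  | Some (Jmp q) => Some (q, m)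
  | Some (SConst l b) => Some (pc.+1, sset m l (if b then 1 else 0))
  | Some (SAdd l l1 l2) => Some (pc.+1, sset m l (sget m l1 + sget m l2))
  | Some (SMul l l1 l2) => Some (pc.+1, sset m l (sget m l1 * sget m l2))
  | Some (SJz l q) => Some (if sget m l == 0 then q else pc.+1, m)
  end.

Definition halts_in (M : nat) (P : program) (m : memory) (t : nat)
    (m' : memory) : Prop :=
  exists pc, iter t (obind (step M P)) (Some (0%N, m)) = Some (pc, m') /\
             (size P <= pc)%N.

(* Before a program is called, its input is copied to the first registers of the
   banks 0; its output is read in the banks 1.  The rest of the memory persists
   from one call to the next. *)
Definition load (ws : seq nat) (ks : seq K) (m : memory) : memory :=
  Memory
    (fun b i => if (b == 0%N) && (i < size ws)%N then nth 0%N ws i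
                else wmem m b i)
    (fun b i => if (b == 0%N) && (i < size ks)%N then nth 0 ks i
                else smem m b i).

End Machine.

Definition word_bound (c N : nat) : nat := (c * N.+2 ^ c)%N.

(** * Dynamic query evaluation *)

Section DynEval.
Variables (K : comNzSemiRingType) (sg : vocabulary) (V : finType).
Variable Q : cq sg V.

Definition fact_words (f : fact sg) : seq nat :=
  val (enum_rank (tag f)) :: [seq val e | e <- tagged f].

(* The input for the preprocessing is a list fs of the facts with nonzero value,
   in an arbitrary order. *)
Definition lists_facts (D : database K sg) (fs : seq (fact sg)) : Prop :=
  uniq fs /\ fs =i finsupp (db_rel D).

Definition db_words (D : database K sg) (fs : seq (fact sg)) : seq nat :=
  size fs :: [seq val (db_cst D c) | c <- enum (cst sg)]
    ++ flatten [seq fact_words f | f <- fs].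

Definition update_words (u : update K sg) : seq nat :=
  match u with
  | Insert f _ => 0%N :: fact_words f
  | Delete f => 1%N :: fact_words f
  end.

Definition update_svals (u : update K sg) : seq K :=
  match u with Insert _ k => [:: k] | Delete _ => [::] end.

Record dyn_algorithm := DynAlgorithm {
  dyn_preprocess : program;
  dyn_update : program;
  dyn_next : program }.

(* A session consists of updates and of requests for the next output.  An
   enumeration starts after the preprocessing and after each update. *)
Inductive request := Update of update K sg | Next.

Definition request_words (r : request) : seq nat :=
  if r is Update u then update_words u else [::].

(* The word W_1[0] tells whether there is an output; if so, the tuple is in
   W_1[1], W_1[2], ... and its value is in S_1[0]. *)
Definition outputs (m : memory K) (d : (size (cq_head Q)).-tuple pnat)
    (k : K) : Prop :=
  [/\ wmem m 1 0 <> 0%N,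
      forall i : 'I_(size (cq_head Q)), wmem m 1 i.+1 = val (tnth d i) &
      smem m 1 0 = k].

(* D is the current database, seen the list of tuples that were output since the
   current enumeration started, and m the current memory. *)
Fixpoint session (A : dyn_algorithm) (c M : nat) (D : database K sg)
    (seen : seq ((size (cq_head Q)).-tuple pnat)) (m : memory K)
    (rs : seq request) : Prop :=
  match rs with
  | [::] => True
  | Update u :: rs' =>
      exists (t : nat) (m' : memory K),
        [/\ halts_in M (dyn_update A)
              (load (update_words u) (update_svals u) m) t m',
            (t <= c)%N &
            session A c M (apply_update u D) [::] m' rs']
  | Next :: rs' =>
      exists (t : nat) (m' : memory K),
        [/\ halts_in M (dyn_next A) m t m',
            (t <= c)%N &
            (wmem m' 1 0 = 0%N /\
             (forall d, query_value D d <> 0 -> d \in seen) /\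
             session A c M D seen m' rs')
            \/
            exists d, [/\ d \notin seen, query_value D d <> 0,
              outputs m' d (query_value D d) &
              session A c M D (d :: seen) m' rs']]
  end.

Definition session_size (D : database K sg) (fs : seq (fact sg))
    (rs : seq request) : nat :=
  (size fs + size rs +
   \max_(w <- db_words D fs ++ flatten [seq request_words r | r <- rs]) w)%N.

(* Constant-time updates and constant delay, after linear preprocessing. *)
Definition dyneval_solvable : Prop :=
  exists (A : dyn_algorithm) (c : nat),
  forall (D : database K sg) (fs : seq (fact sg)) (rs : seq request),
  lists_facts D fs ->
  let M := word_bound c (session_size D fs rs) in
  exists (t : nat) (m : memory K),
    [/\ halts_in M (dyn_preprocess A)
          (load (db_words D fs) [seq db_rel D f | f <- fs] (memory0 K)) t m,
        (t <= c * (db_size D).+1)%N &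
        session A c M D [::] m rs].

End DynEval.

(** * Online Boolean matrix-vector multiplication *)

Definition bool_mulmx n (A : 'M[bool]_n) (v : 'cV[bool]_n) : 'cV[bool]_n :=
  \col_i [exists j, A i j && v j ord0].

Definition mx_words n (A : 'M[bool]_n) : seq nat :=
  [seq nat_of_bool (A i j) | i <- enum 'I_n, j <- enum 'I_n].

Definition vec_words n (v : 'cV[bool]_n) : seq nat :=
  [seq nat_of_bool (v i ord0) | i <- enum 'I_n].

(* The machine only has words at its disposal here: the programs contain no
   semiring instruction, and nat is a dummy semiring. *)
Record omv_algorithm := OmvAlgorithm {
  omv_preprocess : program;
  omv_round : program;
  omv_plain : all word_instr omv_preprocess && all word_instr omv_round }.

(* The vectors vs are handled one after the other, in t steps altogether. *)
Fixpoint omv_rounds (B : omv_algorithm) (M n : nat) (A : 'M[bool]_n)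
    (m : memory nat) (vs : seq 'cV[bool]_n) (t : nat) : Prop :=
  match vs with
  | [::] => t = 0%N
  | v :: vs' =>
      exists (t1 t2 : nat) (m' : memory nat),
        [/\ halts_in M (omv_round B) (load (vec_words v) [::] m) t1 m',
            forall i : 'I_n,
              wmem m' 1 i = nat_of_bool (bool_mulmx A v i ord0),
            omv_rounds B M A m' vs' t2 &
            t = (t1 + t2)%N]
  end.

Definition omv_runs (B : omv_algorithm) (M n : nat) (A : 'M[bool]_n)
    (vs : n.-tuple 'cV[bool]_n) (t : nat) : Prop :=
  exists (t1 t2 : nat) (m : memory nat),
    [/\ halts_in M (omv_preprocess B)
          (load (n :: mx_words A) [::] (memory0 nat)) t1 m,
        omv_rounds B M A m vs t2 &
        t = (t1 + t2)%N].

Definition OMv_conjecture (R : realType) : Prop :=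
  forall eps : R, 0 < eps ->
  ~ exists (B : omv_algorithm) (c : nat) (C : R),
      forall (n : nat) (A : 'M[bool]_n) (vs : n.-tuple 'cV[bool]_n),
      (0 < n)%N ->
      exists t : nat, omv_runs B (word_bound c n) A vs t /\
                      t%:R <= C * (n%:R `^ (3 - eps)).

(* Main.v *)
(* A dynamic evaluation algorithm with constant update time and delay yields an
   algorithm for OMv in time O(n^2).  If Q is not q-hierarchical, there are
   variables x and y, an atom mentioning both, an atom mentioning only y, and
   either an atom mentioning only x, or x is free and y is not.  Map all the
   other variables to 1, store the matrix in the atoms with x and y and the
   vector in the atoms with only y.  In the first case row i of the product is
   obtained by inserting the value i in the atoms with only x and asking for one
   answer; in the second case the nonzero rows are the answers, and there are at
   most n of them.  Constants that bound covered variables are set to n and all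
   the others to 1, so that the uncovered free variables are equal to 1.

   OMv machines have no semiring registers, but only the elements 0, 1, 1+1, ...
   occur, and by zero-sum freeness n.1 = 0 only for n = 0.  Hence k |-> (k != 0)
   is a morphism to the Booleans, and each semiring instruction can be replaced
   by a logical word instruction. *)

From Stdlib Require PeanoNat.
From mathcomp Require Import all_boot all_order all_algebra.
From mathcomp Require Import finmap zify.
From mathcomp Require Import all_classical all_reals exp.
Require Import Defs.

Set Implicit Arguments.
Unset Strict Implicit.
Unset Printing Implicit Defensive.

Import Order.TTheory GRing.Theory Num.Theory.

Local Open Scope nat_scope.

(** * Monotonicity and determinism of machine runs *)

Section Machine.
Variable K : comNzSemiRingType.
Implicit Types (P : program) (m : memory K).

(** The hypothesis on dynamic evaluation fixes the whole list of requests, and through it the word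
    bound, in advance, whereas the vectors of an OMv instance arrive one by one. What bridges the
    gap is that programs are deterministic and that raising the word bound preserves runs: memories
    obtained for different lists coincide under a common bound. The total number of requests is
    bounded beforehand by a polynomial in n, which yields one word bound for the entire run.

    The preprocessing of the given algorithm is only run on the empty database, where linear time
    means constant time; the matrix then arrives as single-tuple insertions.

    The conjecture is about concrete machine programs, so the reduction must be exhibited as one. It
    is written in a small structured language with time-annotated correctness rules, and the unknown
    programs are inlined. *)

Lemma step_monotone M M' P (c c' : nat * memory K) :
  M <= M' -> step M P c = Some c' -> step M' P c = Some c'.
Proof.
case: c => pc m le_MM'; rewrite /step; case: (onth P pc) => [[]|] //.
- move=> l v; case: ifP => // vM; by rewrite (leq_trans vM le_MM').
- move=> o l l1 l2; case: ifP => // vM; by rewrite (leq_trans vM le_MM').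
Qed.

Lemma iter_obind_None (T : Type) (f : T -> option T) t :
  iter t (obind f) None = None.
Proof. by elim: t => //= t ->. Qed.

Lemma iter_step_monotone M M' P t (c c' : nat * memory K) :
  M <= M' -> iter t (obind (step M P)) (Some c) = Some c' ->
  iter t (obind (step M' P)) (Some c) = Some c'.
Proof.
move=> leM; elim: t c => [|t IHt] c //; rewrite !iterSr /=.
case E: (step M P c) => [c1|]; last by rewrite iter_obind_None.
by rewrite (step_monotone leM E) => /IHt.
Qed.

Lemma halts_in_monotone M M' P m t m' :
  M <= M' -> halts_in M P m t m' -> halts_in M' P m t m'.
Proof.
by move=> leM [pc [H1 H2]]; exists pc; split=> //; exact: iter_step_monotone H1.
Qed.

Lemma step_halted M P pc m : size P <= pc -> step M P (pc, m) = None.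
Proof. by move=> le; rewrite /step onth_default. Qed.

(** A halted configuration has no successor, so any further iteration yields [None]: the later halt
    can only be the same one. *)
Lemma halts_in_le M P m t1 m1 t2 m2 :
  t1 <= t2 -> halts_in M P m t1 m1 -> halts_in M P m t2 m2 -> m1 = m2.
Proof.
move=> le [pc1 [H1 E1]] [pc2 [H2 E2]].
move: H2; rewrite -(subnK le) iterD H1.
case: (t2 - t1) => [[_ //]|k].
rewrite iterSr (_ : obind _ _ = None) ?iter_obind_None //.
exact: step_halted.
Qed.

Lemma halts_in_deterministic M P m t1 m1 t2 m2 :
  halts_in M P m t1 m1 -> halts_in M P m t2 m2 -> m1 = m2.
Proof.
move=> H1 H2; case: (leqP t1 t2) => [le|/ltnW le]; first exact: halts_in_le H1 H2.
by apply/esym; exact: halts_in_le H2 H1.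
Qed.

End Machine.

(** * Structured programs *)

(* The memory of a called program is kept apart from that of its caller: its
   word bank b is stored in bank 2b+3 and its semiring bank b in bank 2b+4. *)
Definition wbank b := b.*2.+3.
Definition sbank b := b.*2.+4.

Definition word_loc (l : loc) : loc :=
  match l with
  | Dir b i => Dir (wbank b) i
  | Ind b b' i => Ind (wbank b) (wbank b') i
  end.

Definition semiring_loc (l : loc) : loc :=
  match l with
  | Dir b i => Dir (sbank b) i
  | Ind b b' i => Ind (sbank b) (wbank b') i
  end.

(* A semiring value k is represented by the word (k != 0). *)
Definition translate_instr (base len : nat) (i : instr) : instr :=
  match i with
  | WConst l v => WConst (word_loc l) v
  | WOp o l l1 l2 => WOp o (word_loc l) (word_loc l1) (word_loc l2)
  | WJz l q => WJz (word_loc l) (base + minn q len)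
  | Jmp q => Jmp (base + minn q len)
  | SConst l b => WConst (semiring_loc l) b
  | SAdd l l1 l2 => WOp Or (semiring_loc l) (semiring_loc l1) (semiring_loc l2)
  | SMul l l1 l2 => WOp And (semiring_loc l) (semiring_loc l1) (semiring_loc l2)
  | SJz l q => WJz (semiring_loc l) (base + minn q len)
  end.

(** Structured commands allow correctness to be proved by composition instead of by tracking jumps.
    [While] and [When] run their body when the tested word is nonzero; [Call] inlines a translated
    program. *)
Inductive cmd :=
| Skip
| Const of loc & nat
| Op of wop & loc & loc & loc
| Seq of cmd & cmd
| While of loc & cmd
| When of loc & cmd
| Call of program.

Fixpoint cmd_len (c : cmd) : nat :=
  match c with
  | Skip => 0
  | Const _ _ | Op _ _ _ _ => 1
  | Seq c1 c2 => cmd_len c1 + cmd_len c2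
  | While _ c1 => (cmd_len c1).+2
  | When _ c1 => (cmd_len c1).+1
  | Call P => size P
  end.

Fixpoint compile (base : nat) (c : cmd) : program :=
  match c with
  | Skip => [::]
  | Const l v => [:: WConst l v]
  | Op o l l1 l2 => [:: WOp o l l1 l2]
  | Seq c1 c2 => compile base c1 ++ compile (base + cmd_len c1) c2
  | While l c1 =>
      WJz l (base + (cmd_len c1).+2) :: compile base.+1 c1 ++ [:: Jmp base]
  | When l c1 => WJz l (base + (cmd_len c1).+1) :: compile base.+1 c1
  | Call P => [seq translate_instr base (size P) i | i <- P]
  end.

Lemma size_compile base c : size (compile base c) = cmd_len c.
Proof.
elim: c base => //= [c1 IH1 c2 IH2|l c IH|l c IH|P] base.
- by rewrite size_cat IH1 IH2.
- by rewrite size_cat IH addn1.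
- by rewrite IH.
- by rewrite size_map.
Qed.

Lemma compile_plain base c : all word_instr (compile base c).
Proof.
elim: c base => //= [c1 IH1 c2 IH2|l c IH|P] base.
- by rewrite all_cat IH1 IH2.
- by rewrite all_cat IH.
- by elim: P (size P) => //= -[] //.
Qed.

Implicit Types mu : memory nat.

(** Jump targets are absolute, so the compiled code depends on its position; quantifying over the
    code before and after it is what makes runs compose. *)
Definition runs M (c : cmd) mu t mu' : Prop :=
  forall pre post,
    iter t (obind (step M (pre ++ compile (size pre) c ++ post)))
         (Some (size pre, mu))
    = Some (size pre + cmd_len c, mu').

Definition wp M (c : cmd) T (post : memory nat -> Prop) mu : Prop :=
  exists t mu', [/\ runs M c mu t mu', t <= T & post mu'].

Lemma wp_weaken M c T T' (post post' : memory nat -> Prop) mu :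
  wp M c T post mu -> T <= T' -> (forall mu', post mu' -> post' mu') ->
  wp M c T' post' mu.
Proof.
move=> [t [mu' [H1 H2 H3]]] le H; exists t, mu'; split=> //; last exact: H.
exact: leq_trans le.
Qed.

Lemma wp_halts M c T post mu : wp M c T post mu ->
  exists t mu', [/\ halts_in M (compile 0 c) mu t mu', t <= T & post mu'].
Proof.
move=> [t [mu' [H1 H2 H3]]]; exists t, mu'; split=> //.
exists (cmd_len c); split; last by rewrite size_compile.
by have := H1 [::] [::]; rewrite /= cats0.
Qed.

Lemma wp_skip M (post : memory nat -> Prop) mu : post mu -> wp M Skip 0 post mu.
Proof. by move=> H; exists 0, mu; split=> // pre s; rewrite /= addn0. Qed.

Lemma onth_size_cat (T : Type) (s1 s2 : seq T) k :
  onth (s1 ++ s2) (size s1 + k) = onth s2 k.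
Proof. by rewrite onth_cat ltnNge leq_addr /= addKn. Qed.

Lemma onth_size (T : Type) (s1 s2 : seq T) i :
  onth (s1 ++ i :: s2) (size s1) = Some i.
Proof. by rewrite -[X in onth _ X]addn0 onth_size_cat. Qed.

Lemma wp_const M l v (post : memory nat -> Prop) mu :
  v <= M -> post (wset mu l v) -> wp M (Const l v) 1 post mu.
Proof.
move=> vM H; exists 1, (wset mu l v); split=> // pre s.
by rewrite /= onth_size vM addn1.
Qed.

Lemma wp_op M o l l1 l2 v (post : memory nat -> Prop) mu :
  wop_fun o (wget mu l1) (wget mu l2) = v -> v <= M -> post (wset mu l v) ->
  wp M (Op o l l1 l2) 1 post mu.
Proof.
move=> Ev vM H; exists 1, (wset mu l v); split=> // pre s.
by rewrite /= onth_size Ev vM addn1.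
Qed.

Lemma runs_seq M c1 c2 mu1 mu2 mu3 t1 t2 :
  runs M c1 mu1 t1 mu2 -> runs M c2 mu2 t2 mu3 ->
  runs M (Seq c1 c2) mu1 (t2 + t1) mu3.
Proof.
move=> H1 H2 pre s /=; rewrite iterD -catA H1 addnA.
have := H2 (pre ++ compile (size pre) c1) s.
by rewrite size_cat size_compile -!catA.
Qed.

Lemma wp_seq M c1 c2 T1 T2 post mu :
  wp M c1 T1 (fun mu' => wp M c2 T2 post mu') mu ->
  wp M (Seq c1 c2) (T1 + T2) post mu.
Proof.
move=> [t1 [mu1 [H1 l1 [t2 [mu2 [H2 l2 Hp]]]]]].
exists (t2 + t1), mu2; split=> //; first exact: runs_seq H1 H2.
by rewrite addnC leq_add.
Qed.

Lemma runs_under M i c mu t mu' pre s :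
  runs M c mu t mu' ->
  iter t (obind (step M (pre ++ (i :: compile (size pre).+1 c) ++ s)))
       (Some ((size pre).+1, mu))
  = Some ((size pre).+1 + cmd_len c, mu').
Proof.
move=> H; have := H (rcons pre i) s.
by rewrite size_rcons cat_rcons.
Qed.

Lemma wp_when M l c T (post : memory nat -> Prop) mu :
  (wget mu l = 0 -> post mu) ->
  (wget mu l <> 0 -> wp M c T post mu) -> wp M (When l c) T.+1 post mu.
Proof.
move=> H0 H1; case: (eqVneq (wget mu l) 0) => [E|/eqP N].
  exists 1, mu; split=> //; last exact: H0.
  by move=> pre s /=; rewrite onth_size E eqxx.
have [t [mu' [Hr Ht Hp]]] := H1 N; exists t.+1, mu'; split=> // pre s.
rewrite iterSr /= onth_size; move/eqP/negPf: N => ->.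
by rewrite (runs_under _ _ _ Hr) addSnnS.
Qed.

(** The invariant is indexed by the value of the tested word, which decreases to 0. Each turn costs
    the body, the test and the jump back; the final +1 is the failing test. *)
Lemma wp_while M l c T (I : nat -> memory nat -> Prop) n mu :
  (forall k mu', I k mu' -> wget mu' l = k) ->
  (forall k mu', k < n -> I k.+1 mu' -> wp M c T (I k) mu') ->
  I n mu -> wp M (While l c) (n * T.+2).+1 (I 0) mu.
Proof.
move=> Hl Hc.
suff: forall k mu', k <= n -> I k mu' ->
    wp M (While l c) (k * T.+2).+1 (I 0) mu' by exact.
elim=> [|k IHk] mu1 kn I1.
  exists 1, mu1; split=> // pre s.
  by rewrite /= onth_size (Hl _ _ I1) eqxx.
have [t [mu2 [H2 l2 I2]]] := Hc _ _ kn I1.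
have [t' [mu3 [H3 l3 I3]]] := IHk _ (ltnW kn) I2.
exists (t' + (t.+2)), mu3; split=> //; last first.
  by rewrite mulSn; lia.
move=> pre s.
have Ep : pre ++ compile (size pre) (While l c) ++ s
        = pre ++ (WJz l (size pre + (cmd_len c).+2)
                  :: compile (size pre).+1 c) ++ Jmp (size pre) :: s.
  by rewrite /= -catA.
have Eloop : onth (pre ++ compile (size pre) (While l c) ++ s)
    ((size pre).+1 + cmd_len c) = Some (Jmp (size pre)).
  rewrite Ep addSnnS onth_size_cat.
  by rewrite -(size_compile (size pre).+1 c) [onth _ _]/= onth_size.
rewrite iterD iterS iterSr.
rewrite (_ : obind _ (Some (size pre, mu1)) = Some ((size pre).+1, mu1)); last first.
  by rewrite /= onth_size (Hl _ _ I1).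
have E2 := runs_under (WJz l (size pre + (cmd_len c).+2)) pre (Jmp (size pre) :: s) H2.
rewrite -Ep in E2; rewrite E2.
rewrite (_ : obind _ (Some (_ + _, mu2)) = Some (size pre, mu2)) ?H3 //.
by rewrite [LHS]/step Eloop.
Qed.

(** * Simulation of semiring programs by word programs *)

Section Gen01.
Variable K : comNzSemiRingType.
Hypothesis hK : gen01_zero_sum_free K.

Lemma gen01_natr n : gen01 (n%:R : K)%R.
Proof.
elim: n => [|n IHn]; first by rewrite mulr0n; exact: gen01_0.
by rewrite mulrS; apply: gen01_D => //; exact: gen01_1.
Qed.

Lemma natr_eq0 n : ((n%:R : K) == 0)%R = (n == 0).
Proof.
case: n => [|n]; first by rewrite mulr0n !eqxx.
apply/negbTE/eqP; rewrite mulrS => /(hK (gen01_1 K) (gen01_natr n))[/eqP].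
by rewrite oner_eq0.
Qed.

Lemma gen01P (a : K) : gen01 a -> exists n, a = (n%:R)%R.
Proof.
elim=> [||_ _ _ [n ->] _ [p ->]|_ _ _ [n ->] _ [p ->]].
- by exists 0.
- by exists 1.
- by exists (n + p); rewrite natrD.
- by exists (n * p); rewrite natrM.
Qed.

Lemma gen01_add_neq0 (a b : K) : gen01 a -> gen01 b ->
  (a + b != 0)%R = (a != 0)%R || (b != 0)%R.
Proof.
by move=> /gen01P[n ->] /gen01P[p ->]; rewrite -natrD !natr_eq0 addn_eq0 negb_and.
Qed.

(** Zero-sum freeness speaks of sums only; zero divisors are excluded because every generated
    element is a numeral [n%:R], and a product of numerals is again one, zero only if its index
    is. *)
Lemma gen01_mul_neq0 (a b : K) : gen01 a -> gen01 b ->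
  (a * b != 0)%R = (a != 0)%R && (b != 0)%R.
Proof.
by move=> /gen01P[n ->] /gen01P[p ->]; rewrite -natrM !natr_eq0 muln_eq0 negb_or.
Qed.

Lemma gen01_prod (I : eqType) (s : seq I) (F : I -> K) :
  {in s, forall i, gen01 (F i)} ->
  gen01 (\prod_(i <- s) F i)%R /\
  (\prod_(i <- s) F i != 0)%R = all (fun i => F i != 0)%R s.
Proof.
elim: s => [|i s IHs] H; first by rewrite big_nil /= oner_eq0; split=> //; constructor.
rewrite big_cons /=; have [j js|H1 H2] := IHs.
  by apply: H; rewrite inE js orbT.
have Hi : gen01 (F i) by apply: H; rewrite mem_head.
by rewrite gen01_mul_neq0 // H2; split=> //; constructor.
Qed.

Lemma gen01_sum (I : eqType) (s : seq I) (F : I -> K) :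
  {in s, forall i, gen01 (F i)} ->
  gen01 (\sum_(i <- s) F i)%R /\
  (\sum_(i <- s) F i != 0)%R = has (fun i => F i != 0)%R s.
Proof.
elim: s => [|i s IHs] H; first by rewrite big_nil /= eqxx; split=> //; constructor.
rewrite big_cons /=; have [j js|H1 H2] := IHs.
  by apply: H; rewrite inE js orbT.
have Hi : gen01 (F i) by apply: H; rewrite mem_head.
by rewrite gen01_add_neq0 // H2; split=> //; constructor.
Qed.

Implicit Type m : memory K.

(** The clause on [gen01] makes the flags compositional: outside the generated subsemiring, the
    flags of two operands need not determine whether their sum or product vanishes. *)
Definition simulates mu m : Prop :=
  [/\ forall b i, wmem mu (wbank b) i = wmem m b i,
      forall b i, wmem mu (sbank b) i = (smem m b i != 0)%R &
      forall b i, gen01 (smem m b i)].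

(** Banks 0, 1 and 2 belong to the caller: its input, its output and its registers. *)
Definition same_caller mu mu' : Prop :=
  forall b i, b < 3 -> wmem mu' b i = wmem mu b i.

Lemma wbank_inj b b' : (wbank b == wbank b') = (b == b').
Proof. by rewrite /wbank; lia. Qed.
Lemma sbank_inj b b' : (sbank b == sbank b') = (b == b').
Proof. by rewrite /sbank; lia. Qed.
Lemma wbank_neq_sbank b b' : (wbank b == sbank b') = false.
Proof. by rewrite /wbank /sbank; lia. Qed.

Section Sim.
Variables (mu : memory nat) (m : memory K).
Hypothesis sim : simulates mu m.

Lemma address_word l :
  address mu (word_loc l) = (wbank (address m l).1, (address m l).2).
Proof. by case: sim => H _ _; case: l => //= b b' i; rewrite H. Qed.

Lemma address_semiring l :
  address mu (semiring_loc l) = (sbank (address m l).1, (address m l).2).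
Proof. by case: sim => H _ _; case: l => //= b b' i; rewrite H. Qed.

Lemma wget_word l : wget mu (word_loc l) = wget m l.
Proof. by rewrite /wget address_word; case: sim => ->. Qed.

Lemma wget_semiring l : wget mu (semiring_loc l) = (sget m l != 0)%R.
Proof. by rewrite /wget address_semiring; case: sim => _ ->. Qed.

Lemma gen01_sget l : gen01 (sget m l).
Proof. by case: sim => _ _; apply. Qed.

Lemma simulates_wset l v :
  simulates (wset mu (word_loc l) v) (wset m l v) /\
  same_caller mu (wset mu (word_loc l) v).
Proof.
case: sim => H1 H2 H3; split; first split.
- move=> b i; rewrite /wset /= address_word; case: (address m l) => b' i' /=.
  by rewrite !xpair_eqE wbank_inj H1.
- move=> b i; rewrite /wset /= address_word; case: (address m l) => b' i' /=.
  by rewrite !xpair_eqE eq_sym wbank_neq_sbank H2.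
- exact: H3.
- move=> b i b3; rewrite /wset /= address_word xpair_eqE /=.
  by case: eqP => // Eb; move: b3; rewrite Eb.
Qed.

Lemma simulates_sset l v : gen01 v ->
  simulates (wset mu (semiring_loc l) (v != 0)%R) (sset m l v) /\
  same_caller mu (wset mu (semiring_loc l) (v != 0)%R).
Proof.
case: sim => H1 H2 H3 gv; split; first split.
- move=> b i; rewrite /wset /= address_semiring; case: (address m l) => b' i' /=.
  by rewrite !xpair_eqE wbank_neq_sbank H1.
- move=> b i; rewrite /wset /= address_semiring; case: (address m l) => b' i' /=.
  by rewrite !xpair_eqE sbank_inj; case: ifP; rewrite ?H2.
- by move=> b i /=; case: ifP.
- move=> b i b3; rewrite /wset /= address_semiring xpair_eqE /=.
  by case: eqP => // Eb; move: b3; rewrite Eb.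
Qed.

End Sim.

Lemma same_caller_trans mu1 mu2 mu3 :
  same_caller mu1 mu2 -> same_caller mu2 mu3 -> same_caller mu1 mu3.
Proof. by move=> H1 H2 b i b3; rewrite H2 // H1. Qed.

(** Program counters are cut at [size P]: a program may halt at any counter beyond its end, and in
    the inlined copy all of these become the instruction that follows the call. The bound [M'] is
    positive since a flag can be 1. *)
Lemma step_simulation M M' P pc m pc' m' mu :
  0 < M' -> M <= M' -> simulates mu m ->
  step M P (pc, m) = Some (pc', m') ->
  exists mu', [/\ forall pre post,
    step M' (pre ++ compile (size pre) (Call P) ++ post)
         (size pre + minn pc (size P), mu)
      = Some (size pre + minn pc' (size P), mu'),
    simulates mu' m' & same_caller mu mu'].
Proof.
move=> M'0 MM' sim; rewrite /step.
case E: (onth P pc) => [i|//].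
have ltpc : pc < size P by rewrite -onthTE E.
have Epc : minn pc (size P) = pc by lia.
have Spc s : (s + pc).+1 = s + minn pc.+1 (size P) by lia.
have Eonth pre post : onth (pre ++ compile (size pre) (Call P) ++ post)
    (size pre + minn pc (size P)) = Some (translate_instr (size pre) (size P) i).
  by rewrite Epc onth_size_cat onth_cat size_map ltpc onth_map E.
case: i Eonth {E} => /= [l v|o l l1 l2|l q|q|l b|l l1 l2|l l1 l2|l q] Eonth.
- case: ifP => // vM [<- <-]; exists (wset mu (word_loc l) v).
  have [? ?] := simulates_wset sim l v; split=> // pre post.
  by rewrite Eonth (leq_trans vM MM') Epc Spc.
- case: ifP => // vM [<- <-]; eexists; have [? ?] := simulates_wset sim l
    (wop_fun o (wget m l1) (wget m l2)); split; [|eassumption|eassumption].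
  by move=> pre post; rewrite Eonth !(wget_word sim) (leq_trans vM MM') Epc Spc.
- move=> [<- <-]; exists mu; split=> // pre post.
  by rewrite Eonth (wget_word sim) Epc Spc; case: ifP.
- by move=> [<- <-]; exists mu; split=> // pre post; rewrite Eonth.
- move=> [<- <-].
  have gv : gen01 (if b then 1 else 0 : K)%R by case: b {Eonth}; constructor.
  have [H1 H2] := simulates_sset sim l gv.
  eexists; split; [|exact: H1|exact: H2] => pre post.
  rewrite Eonth (_ : b <= M'); last by case: b {Eonth gv H1 H2}.
  rewrite Epc Spc; congr (Some (_, wset _ _ _)).
  by case: (b); rewrite ?oner_eq0 ?eqxx.
- move=> [<- <-].
  have gv : gen01 (sget m l1 + sget m l2)%R by constructor; exact: gen01_sget sim _.
  have [H1 H2] := simulates_sset sim l gv.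
  eexists; split; [|exact: H1|exact: H2] => pre post.
  rewrite Eonth !(wget_semiring sim) [wop_fun _ _ _]/=.
  have -> : Nat.lor (sget m l1 != 0)%R (sget m l2 != 0)%R
          = (sget m l1 + sget m l2 != 0)%R.
    by rewrite gen01_add_neq0; do ?exact: gen01_sget sim _; do 2!case: (_ != _).
  by rewrite (leq_trans (leq_b1 _) M'0) Epc Spc.
- move=> [<- <-].
  have gv : gen01 (sget m l1 * sget m l2)%R by constructor; exact: gen01_sget sim _.
  have [H1 H2] := simulates_sset sim l gv.
  eexists; split; [|exact: H1|exact: H2] => pre post.
  rewrite Eonth !(wget_semiring sim) [wop_fun _ _ _]/=.
  have -> : Nat.land (sget m l1 != 0)%R (sget m l2 != 0)%R
          = (sget m l1 * sget m l2 != 0)%R.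
    by rewrite gen01_mul_neq0; do ?exact: gen01_sget sim _; do 2!case: (_ != _).
  by rewrite (leq_trans (leq_b1 _) M'0) Epc Spc.
- move=> [<- <-]; exists mu; split=> // pre post.
  by rewrite Eonth (wget_semiring sim) Epc Spc; case: (sget m l == 0)%R.
Qed.

Lemma iter_step_simulation M M' P t pc m pc' m' mu :
  0 < M' -> M <= M' -> simulates mu m ->
  iter t (obind (step M P)) (Some (pc, m)) = Some (pc', m') ->
  exists mu', [/\ forall pre post,
    iter t (obind (step M' (pre ++ compile (size pre) (Call P) ++ post)))
         (Some (size pre + minn pc (size P), mu))
      = Some (size pre + minn pc' (size P), mu'),
    simulates mu' m' & same_caller mu mu'].
Proof.
move=> M'0 MM'; elim: t pc m mu => [|t IHt] pc m mu sim.
  by move=> [<- <-]; exists mu.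
rewrite !iterSr; case E: (obind _ _) => [[q2 m2]|]; last by rewrite iter_obind_None.
move=> H.
have [mu2 [E2 sim2 same2]] := step_simulation M'0 MM' sim E.
have [mu3 [E3 sim3 same3]] := IHt _ _ _ sim2 H.
exists mu3; split=> //; last exact: same_caller_trans same2 same3.
by move=> pre post; rewrite iterSr -(E3 pre post) -(E2 pre post).
Qed.

Lemma wp_call M M' P t m m' mu :
  0 < M' -> M <= M' -> simulates mu m -> halts_in M P m t m' ->
  wp M' (Call P) t (fun mu' => simulates mu' m' /\ same_caller mu mu') mu.
Proof.
move=> M'0 MM' sim [pc [Hit Hpc]].
have [mu' [H sim' same']] := iter_step_simulation M'0 MM' sim Hit.
exists t, mu'; split=> // pre post.
by have := H pre post; rewrite min0n addn0 => ->; rewrite (minn_idPr Hpc).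
Qed.

End Gen01.
(** * Sessions of bounded length *)

Section Sessions.
Variables (K : comNzSemiRingType) (sg : vocabulary) (V : finType).
Variables (Q : cq sg V) (A : dyn_algorithm) (c : nat).
Implicit Types (D : database K sg) (m : memory K) (r : request K sg).
Implicit Types (seen : seq ((size (cq_head Q)).-tuple pnat)).

Lemma session_monotone M M' D seen m rs :
  M <= M' -> session A c M D seen m rs -> session A c M' D seen m rs.
Proof.
move=> leM; elim: rs D seen m => //= -[u|] rs IH D seen m.
  move=> [t [m' [H1 H2 H3]]]; exists t, m'; split=> //; last exact: IH.
  exact: halts_in_monotone leM H1.
move=> [t [m' [H1 H2 H3]]]; exists t, m'; split=> //.
  exact: halts_in_monotone leM H1.
case: H3 => [[E [H3 H4]]|[d [H3 H4 H5 H6]]]; [left|right].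
  by split=> //; split=> //; exact: IH.
by exists d; split=> //; exact: IH.
Qed.

Definition bounded_request B r := all (leq^~ B) (request_words r).

(* Quantifying over all short lists allows one to choose the requests online:
   the memory is the same for all of them, as programs are deterministic. *)
Definition serves M B k D seen m : Prop :=
  forall rs, size rs <= k -> all (bounded_request B) rs ->
  session A c M D seen m rs.

(** The next memory is produced by the one-request list; every longer list that begins with the same
    request passes through it, by determinism. *)
Lemma serves_update M B k D seen m u :
  bounded_request B (Update u) -> serves M B k.+1 D seen m ->
  exists t m', [/\ halts_in M (dyn_update A)
                     (load (update_words u) (update_svals u) m) t m',
                   t <= c & serves M B k (apply_update u D) [::] m'].
Proof.
move=> Bu H; have [|t [m' [H1 H2 _]]] := H [:: Update u] isT.
  by rewrite /= Bu.
exists t, m'; split=> // rs rsk Brs.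
have [|t' [m2 [H1' _ ]]] := H (Update u :: rs) rsk; first by rewrite /= Bu.
by rewrite (halts_in_deterministic H1' H1).
Qed.

(** Besides the memory, the different lists must agree on whether an answer is given and on which
    tuple: both are read off the output bank, which is the same. *)
Lemma serves_next M B k D seen m :
  serves M B k.+1 D seen m ->
  exists t m', [/\ halts_in M (dyn_next A) m t m', t <= c &
    [/\ wmem m' 1 0 = 0, (forall d, query_value D d <> 0%R -> d \in seen) &
        serves M B k D seen m'] \/
    exists d, [/\ d \notin seen, query_value D d <> 0%R,
                  outputs m' d (query_value D d) &
                  serves M B k D (d :: seen) m']].
Proof.
move=> H; have [//|t [m' [H1 H2 H3]]] := H [:: Next _ _] isT.
exists t, m'; split=> //; case: H3 => [[E [H3 _]]|[d [H3 H4 H5 _]]]; [left|right].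
  split=> // rs rsk Brs.
  have [//|t' [m2 [H1' _ ]]] := H (Next _ _ :: rs) rsk.
  rewrite (halts_in_deterministic H1' H1) => -[[_ [_ //]]|[d [_ _ [/(_ E)]]]].
  by [].
exists d; split=> // rs rsk Brs.
have [//|t' [m2 [H1' _ ]]] := H (Next _ _ :: rs) rsk.
rewrite (halts_in_deterministic H1' H1); case: H5 => E1 E2 _.
move=> -[[/E1//]|[d' [_ _ [_ E2' _]]]].
suff -> : d' = d by [].
by apply: eq_from_tnth => i; apply: val_inj; rewrite /= -E2 E2'.
Qed.

Lemma serves_le M B k k' D seen m :
  k' <= k -> serves M B k D seen m -> serves M B k' D seen m.
Proof. by move=> le H rs rsk; apply: H; exact: leq_trans le. Qed.

End Sessions.

(** * Databases that encode a matrix and two vectors *)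

Lemma uniq_map_inj_in (T1 T2 : eqType) (f : T1 -> T2) (s : seq T1) :
  uniq (map f s) -> {in s &, injective f}.
Proof.
elim: s => //= z s IHs /andP[fz us] a b; rewrite !inE.
move=> /orP[/eqP->|sa] /orP[/eqP->|sb] // E.
- by move: fz; rewrite E map_f.
- by move: fz; rewrite -E map_f.
- exact: IHs.
Qed.

Section Encoding.
Variables (K : comNzSemiRingType) (sg : vocabulary) (V : finType).
Variables (Q : cq sg V) (x y : V) (n : nat).
Hypothesis hK : gen01_zero_sum_free K.
Hypothesis hjoins : no_self_joins Q.
Hypothesis neq_xy : x != y.
Implicit Types (D : database K sg) (a : ratom sg V) (nu : {ffun V -> pnat}).
Implicit Types (p q : pnat) (P : ratom sg V -> nat -> nat -> bool).

Definition pone : pnat := exist _ 1 isT.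

Definition ground nu a : fact sg :=
  Tagged (fun r : rel sg => (arity r).-tuple pnat) (map_tuple nu (tagged a)).

Definition point p q : {ffun V -> pnat} :=
  [ffun z => if z == x then p else if z == y then q else pone].

(* 0 is not the value of any variable. *)
Definition coord (z : V) a (i : nat) := if z \in tagged a then i else 0.

(* P tells which pairs of values of x and y occur in the facts of each atom; all
   the other variables are always mapped to 1. *)
Definition holds P nu a : bool :=
  all (fun z => [|| z == x, z == y | val (nu z) == 1]) (tagged a) &&
  P a (coord x a (val (nu x))) (coord y a (val (nu y))).

Definition covered_cst (e : cst sg) : bool :=
  [exists z, covered Q z && ((z, e) \in cq_cmps Q)].

Definition cst_value (e : cst sg) : nat := if covered_cst e then n else 1.

(** Values are tracked only up to being nonzero, so an insertion may hit a fact that is already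
    present. Facts that no valuation of an atom of [Q] produces are unconstrained. *)
Definition encodes D P : Prop :=
  (forall e, val (db_cst D e) = cst_value e) /\
  (forall a nu, a \in cq_rels Q ->
     gen01 (eval_ratom D nu a) /\ (eval_ratom D nu a != 0)%R = holds P nu a).

(** When [i'] and [j'] are coordinates of [a], a variable that [a] does not mention gives 0 on both
    sides and imposes no condition. *)
Definition hit (L : seq (ratom sg V)) (i j : nat) a (i' j' : nat) : bool :=
  [&& a \in L, i' == coord x a i & j' == coord y a j].

Definition updP (b : bool) P L i j : ratom sg V -> nat -> nat -> bool :=
  fun a i' j' => if hit L i j a i' j' then b else P a i' j'.

Lemma point_x p q : point p q x = p.
Proof. by rewrite ffunE eqxx. Qed.

Lemma point_y p q : point p q y = q.
Proof. by rewrite ffunE eq_sym (negPf neq_xy) eqxx. Qed.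

(** Without self-joins the relation symbol of a fact determines the atom, so a single-tuple update
    changes one atom only, and there only at the coordinates that the atom mentions. *)
Lemma ground_eq nu a a0 p q :
  a \in cq_rels Q -> a0 \in cq_rels Q ->
  (ground nu a == ground (point p q) a0) =
  all (fun z => [|| z == x, z == y | val (nu z) == 1]) (tagged a) &&
  hit [:: a0] (val p) (val q) a (coord x a (val (nu x))) (coord y a (val (nu y))).
Proof.
move=> aQ a0Q; apply/eqP/andP => [E|[/allP H /and3P[]]].
  have Ea : a = a0.
    apply: (uniq_map_inj_in hjoins) => //.
    exact: (congr1 (@tag _ _) E).
  rewrite -{a0 a0Q}Ea in E *.
  have Enu : {in tagged a, nu =1 point p q}.
    apply/eq_in_map; move/eqP: E.
    by rewrite /ground -tag_eqE /tag_eq /= eqxx tagged_asE => /eqP[].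
  split.
    apply/allP => z za; rewrite (Enu _ za) ffunE.
    by case: eqP => //= _; case: eqP.
  rewrite /hit mem_head /= /coord; apply/andP; split; case: ifP => // za.
    by rewrite (Enu _ za) point_x.
  by rewrite (Enu _ za) point_y.
rewrite inE => /eqP Ea; rewrite -{a0 a0Q}Ea /coord => E1 E2.
rewrite /ground; congr (Tagged _ _); apply: val_inj => /=; apply/eq_in_map => z za.
rewrite ffunE; case: eqP => [zx|/eqP zx].
  by move: E1; rewrite -zx za => /eqP/val_inj.
case: eqP => [zy|/eqP zy].
  by move: E2; rewrite -zy za => /eqP/val_inj.
by have := H _ za; rewrite (negPf zx) (negPf zy) => /eqP E; apply: val_inj.
Qed.

Lemma encodes_insert D P a p q : a \in cq_rels Q -> encodes D P ->
  encodes (apply_update (Insert (ground (point p q) a) 1%R) D)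
          (updP true P [:: a] (val p) (val q)).
Proof.
move=> aQ [H1 H2]; split=> //= a' nu a'Q.
have [g E] := H2 _ nu a'Q; rewrite /eval_ratom /= fsfun_withE.
rewrite -/(ground nu a') ground_eq //.
rewrite /holds /updP; case: (boolP (all _ _)) => /= al; last first.
  by move: E; rewrite /holds (negPf al).
case: ifP => h; last by move: E; rewrite /holds al.
have ge : ground nu a' = ground (point p q) a.
  by apply/eqP; rewrite ground_eq // al.
have g1 : gen01 (1 : K)%R by constructor.
rewrite -ge gen01_add_neq0 // oner_neq0 orbT; split=> //; exact: gen01_D.
Qed.

Lemma encodes_delete D P a p q : a \in cq_rels Q -> encodes D P ->
  encodes (apply_update (Delete (ground (point p q) a)) D)
          (updP false P [:: a] (val p) (val q)).
Proof.
move=> aQ [H1 H2]; split=> //= a' nu a'Q.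
have [g E] := H2 _ nu a'Q; rewrite /eval_ratom /= fsfun_withE.
rewrite -/(ground nu a') ground_eq //.
rewrite /holds /updP; case: (boolP (all _ _)) => /= al; last first.
  by move: E; rewrite /holds (negPf al).
case: ifP => h; last by move: E; rewrite /holds al.
by rewrite eqxx; split=> //; constructor.
Qed.

Lemma encodes_ext D P P' :
  (forall a i j, a \in cq_rels Q -> P a (coord x a i) (coord y a j)
     = P' a (coord x a i) (coord y a j)) ->
  encodes D P -> encodes D P'.
Proof.
move=> E [H1 H2]; split=> // a nu aQ; have [g ->] := H2 a nu aQ.
by split=> //; rewrite /holds E.
Qed.

Definition satisfies P nu : bool :=
  all (holds P nu) (cq_rels Q) &&
  all (fun e => val (nu e.1) <= cst_value e.2) (cq_cmps Q).

Definition answer P (d : (size (cq_head Q)).-tuple pnat) : Prop :=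
  exists2 nu : {ffun V -> pnat}, map nu (cq_head Q) = d :> seq pnat & satisfies P nu.

Lemma eval_body_satisfies D P nu : encodes D P ->
  gen01 (eval_body Q D nu) /\ (eval_body Q D nu != 0)%R = satisfies P nu.
Proof.
move=> [H1 H2].
have [|g1 E1] := gen01_prod hK (s := cq_rels Q) (F := eval_ratom D nu).
  by move=> a aQ; have [] := H2 a nu aQ.
have [|g2 E2] := gen01_prod hK (s := cq_cmps Q) (F := eval_cmp D nu).
  by move=> e _; rewrite /eval_cmp; case: ifP; constructor.
rewrite /eval_body gen01_mul_neq0 // E1 E2; split; first exact: gen01_M.
congr andb.
  by apply: eq_in_all => a aQ; have [] := H2 a nu aQ.
apply: eq_all => e; rewrite /eval_cmp H1.
by case: ifP; rewrite ?oner_neq0 ?eqxx.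
Qed.

(** The sum defining [query_value] is 0 by convention when its support is infinite; this bound makes
    the satisfying valuations finitely many. *)
Definition boundedP P : Prop := forall a i j, a \in cq_rels Q ->
  P a (coord x a i) (coord y a j) -> coord x a i <= n /\ coord y a j <= n.

Lemma satisfies_le P nu z : 0 < n -> boundedP P -> satisfies P nu -> val (nu z) <= n.
Proof.
move=> n0 bP /andP[/allP Hr /allP Hc].
have [[a aQ za]|[e ze]] := cq_vars Q z; last first.
  by apply: leq_trans (Hc _ ze) _; rewrite /cst_value; case: ifP.
have /andP[/allP /(_ _ za)] := Hr a aQ.
by move=> /or3P[/eqP Ez|/eqP Ez|/eqP-> //] /(bP _ _ _ aQ); rewrite /coord -Ez za => -[].
Qed.

Lemma finite_satisfies P : 0 < n -> boundedP P ->
  finite_set [set nu | satisfies P nu].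
Proof.
move=> n0 bP.
pose f (h : {ffun V -> 'I_n}) : {ffun V -> pnat} :=
  [ffun z => exist (fun k => 0 < k) (h z).+1 isT].
apply: (@sub_finite_set _ _ (f @` setT)); last exact: finite_image.
move=> nu /= /(satisfies_le _ n0 bP) le.
have lt z : (val (nu z)).-1 < n.
  by rewrite prednK; [exact: le|exact: (valP (nu z))].
exists [ffun z => Ordinal (lt z)] => //; apply/ffunP => z; rewrite !ffunE.
by apply: val_inj; rewrite /= prednK //; exact: (valP (nu z)).
Qed.

(** No cancellation: all terms lie in the zero-sum free subsemiring, so the sum is nonzero as soon
    as one term is. *)
Lemma query_valueP D P d : 0 < n -> boundedP P -> encodes D P ->
  query_value D d <> 0%R <-> answer P d.
Proof.
move=> n0 bP enc; rewrite /query_value.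
have fin : finite_set ([set nu : {ffun V -> pnat} |
    [seq nu z | z <- cq_head Q] = d :> seq pnat]
    `&` (eval_body Q D) @^-1` [set~ 0%R])%classic.
  apply: sub_finite_set (finite_satisfies n0 bP) => nu [_ /= /eqP].
  by have [_ ->] := eval_body_satisfies nu enc.
set s := finite_support _ _ _.
have [|_ E] := gen01_sum hK (s := s) (F := eval_body Q D).
  by move=> nu _; have [] := eval_body_satisfies nu enc.
have -> : forall v : K, v <> 0%R <-> v != 0%R by move=> v; split=> /eqP.
rewrite E; split=> [/hasP[nu]|[nu Ed sat]].
  rewrite in_finite_support // inE => -[/= Ed _].
  by have [_ ->] := eval_body_satisfies nu enc; exists nu.
apply/hasP; exists nu; have [_ E'] := eval_body_satisfies nu enc; rewrite ?E' //.
by rewrite in_finite_support // inE; split=> //=; apply/eqP; rewrite E'.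
Qed.

End Encoding.
Lemma wp_bind M c1 c2 T1 T2 (mid post : memory nat -> Prop) mu :
  wp M c1 T1 mid mu -> (forall mu', mid mu' -> wp M c2 T2 post mu') ->
  wp M (Seq c1 c2) (T1 + T2) post mu.
Proof. by move=> H1 H2; apply: wp_seq; apply: wp_weaken H1 (leqnn _) H2. Qed.

(** * The programs of the reduction *)

(* Bank 2 holds the registers of the reduction: 0 is the dimension n, 1 and 2 are
   the current values of x and y, 3 is a scratch register, 4 is the constant 1. *)
Notation reg i := (Dir 2 i).

(** Counting down turns the loop condition into a test for zero, and the body sees the values n,
    ..., 1, which are the domain elements in use. [Or] of a register with itself is a move; the
    constant 1 sits in a register because operations have no immediate operands. *)
Definition for_loop r body :=
  Seq (Op Or (reg r) (reg 0) (reg 0))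
      (While (reg r) (Seq body (Op Sub (reg r) (reg r) (reg 4)))).

Lemma wp_for M r body T n (I : nat -> memory nat -> Prop) mu :
  n <= M -> wmem mu 2 0 = n ->
  (forall k mu', I k mu' -> wmem mu' 2 r = k) ->
  (forall k mu', k < n -> I k.+1 mu' ->
     wp M body T (fun mu2 => [/\ wmem mu2 2 r = k.+1, wmem mu2 2 4 = 1 &
                                 I k (wset mu2 (reg r) k)]) mu') ->
  I n (wset mu (reg r) n) -> wp M (for_loop r body) (n * T.+3).+2 (I 0) mu.
Proof.
move=> nM En HI Hbody Hn.
have -> : (n * T.+3).+2 = 1 + (n * (T + 1).+2).+1 by rewrite addn1.
apply: wp_seq; apply: (@wp_op _ _ _ _ _ n) => //.
  by rewrite /wget /= En PeanoNat.Nat.lor_diag.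
apply: wp_while Hn => // k mu' kn Ik.
apply: wp_bind (Hbody _ _ kn Ik) _ => mu2 [E1 E2 I2].
apply: (@wp_op _ _ _ _ _ k) I2; last by lia.
by rewrite /wget /= E1 E2 subn1.
Qed.

Definition operand := (nat + nat)%type.

Definition operand_value mu (o : operand) : nat :=
  match o with inl v => v | inr r => wmem mu 2 r end.

(** Writes the arguments of a call where the inlined program expects its input, and so plays the
    role of [load]. *)
Fixpoint put (k : nat) (os : seq operand) : cmd :=
  match os with
  | [::] => Skip
  | o :: os' =>
      Seq (match o with
           | inl v => Const (Dir (wbank 0) k) v
           | inr r => Op Or (Dir (wbank 0) k) (reg r) (reg r)
           end) (put k.+1 os')
  end.

Lemma wp_put M k os mu : all (fun o => operand_value mu o <= M) os ->
  wp M (put k os) (size os) (fun mu' => forall b i, wmem mu' b i =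
    if (b == 3) && (k <= i < k + size os)
    then nth 0 (map (operand_value mu) os) (i - k) else wmem mu b i) mu.
Proof.
elim: os k mu => [|o os IH] k mu.
  move=> _; apply: wp_skip => b i /=; rewrite addn0.
  by rewrite [k <= i < k](_ : _ = false) ?andbF //; lia.
move=> /= /andP[oM osM]; rewrite -[X in wp _ _ X]add1n.
pose mu1 := wset mu (Dir 3 k) (operand_value mu o).
apply: (@wp_bind _ _ _ _ _ (fun mu' => mu' = mu1)).
  rewrite {}/mu1; case: o oM => [v|r] oM; first exact: wp_const.
  by apply: wp_op => //; rewrite /= PeanoNat.Nat.lor_diag.
move=> _ ->.
have Ev o' : operand_value mu1 o' = operand_value mu o' by case: o'.
apply: wp_weaken (IH k.+1 mu1 _) (leqnn _) _.
  by rewrite (eq_all (a2 := fun o => operand_value mu o <= M)) // => o'; rewrite Ev.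
move=> mu' H b i; rewrite H (eq_map Ev) /mu1 /= xpair_eqE.
case: (b =P 3) => //= _.
case: (ltngtP i k) => [ik|ki|->] /=.
- by [].
- rewrite (_ : i < k.+1 + size os = (i < k + (size os).+1)) ?addSnnS //.
  by rewrite -[i - k](@prednK) ?subn_gt0 //= subnS.
- by rewrite subnn /= -[X in X < _]addn0 ltn_add2l.
Qed.

Section Load.
Variable K : comNzSemiRingType.

Lemma simulates_load mu mu' (m : memory K) ws ks :
  simulates mu m ->
  (forall b i, wmem mu' (wbank b) i = if (b == 0) && (i < size ws)
     then nth 0 ws i else wmem mu (wbank b) i) ->
  (forall b i, wmem mu' (sbank b) i = if (b == 0) && (i < size ks)
     then (nth 0 ks i != 0)%R : nat else wmem mu (sbank b) i) ->
  (forall i, gen01 (nth 0 ks i)%R) ->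
  simulates mu' (load ws ks m).
Proof.
move=> [H1 H2 H3] E1 E2 E3; split=> b i /=.
- by rewrite E1 H1.
- by rewrite E2 H2; case: ifP.
- by case: ifP.
Qed.

Lemma simulates_ext mu mu' (m : memory K) :
  (forall b i, 2 < b -> wmem mu' b i = wmem mu b i) ->
  simulates mu m -> simulates mu' m.
Proof. by move=> E [H1 H2 H3]; split=> // b i; rewrite E ?H1 ?H2. Qed.

End Load.

(** * States of the reduction and updates of the atoms *)

Section Reduction.
Variables (K : comNzSemiRingType) (sg : vocabulary) (V : finType).
Variables (Q : cq sg V) (x y : V).
Variables (A : dyn_algorithm) (c : nat).
Hypothesis hK : gen01_zero_sum_free K.
Hypothesis hjoins : no_self_joins Q.
Hypothesis neq_xy : x != y.
Implicit Types (D : database K sg) (a : ratom sg V) (L : seq (ratom sg V)).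
Implicit Types (P : ratom sg V -> nat -> nat -> bool).
Implicit Types (seen : seq ((size (cq_head Q)).-tuple pnat)).

(** Produces the words of [update_words] for the fact obtained from [a] at the current values of x
    and y: the code of the operation, the rank of the symbol, then the tuple. *)
Definition atom_operands (b : bool) a : seq operand :=
  inl (nat_of_bool (~~ b)) :: inl (val (enum_rank (tag a))) ::
  [seq if z == x then inr 1 else if z == y then inr 2 else inl 1 | z <- tagged a].

Definition update_cmd b a : cmd :=
  Seq (put 0 (atom_operands b a))
      (Seq (if b then Const (Dir (sbank 0) 0) 1 else Skip) (Call (dyn_update A))).

Definition update_cmds b L : cmd :=
  foldr (fun a => Seq (update_cmd b a)) Skip L.

Definition update_time a : nat := arity (tag a) + c + 3.

Definition updates_time L : nat := sumn (map update_time L).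

Section Fixed.
Variables (n M : nat).
(** Bounds every word of a request: operation codes are at most 1, ranks of symbols are below
    [#|rel sg|], and domain values are at most n. *)
Definition word_limit := n + #|rel sg| + 2.
Hypothesis n_gt0 : 0 < n.
Hypothesis M_big : word_limit <= M.
Hypothesis M_sqr : n * n + n <= M.

(** The database and the memory of the given algorithm are ghosts, tied to [mu] by the simulation;
    [k] is a budget of requests, from which each update and each demand for an answer takes one. *)
Definition state k P seen mu : Prop :=
  exists D (m : memory K),
    [/\ simulates mu m, serves A c M word_limit k D seen m,
        encodes Q x y n D P, wmem mu 2 0 = n & wmem mu 2 4 = 1].

Lemma state_frame k P seen mu mu' :
  (forall b i, 2 < b -> wmem mu' b i = wmem mu b i) ->
  wmem mu' 2 0 = wmem mu 2 0 -> wmem mu' 2 4 = wmem mu 2 4 ->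
  state k P seen mu -> state k P seen mu'.
Proof.
move=> E E0 E4 [D [m [H1 H2 H3 H4 H5]]]; exists D, m; split=> //.
- exact: simulates_ext H1.
- by rewrite E0.
- by rewrite E4.
Qed.

Lemma state_ext k P P' seen mu :
  (forall a i j, a \in cq_rels Q -> P a (coord x a i) (coord y a j)
     = P' a (coord x a i) (coord y a j)) ->
  state k P seen mu -> state k P' seen mu.
Proof.
move=> E [D [m [H1 H2 H3 H4 H5]]]; exists D, m; split=> //; exact: encodes_ext H3.
Qed.

Lemma state_le k k' P seen mu : k' <= k -> state k P seen mu -> state k' P seen mu.
Proof.
move=> le [D [m [H1 H2 H3 H4 H5]]]; exists D, m; split=> //; exact: serves_le H2.
Qed.

Lemma wp_update b a i j k P seen mu :
  a \in cq_rels Q -> 0 < i <= n -> 0 < j <= n ->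
  wmem mu 2 1 = i -> wmem mu 2 2 = j -> state k.+1 P seen mu ->
  wp M (update_cmd b a) (update_time a) (fun mu' => same_caller mu mu' /\
    state k (updP x y b P [:: a] i j) [::] mu') mu.
Proof.
move=> aQ /andP[i0 ni] /andP[j0 nj] Ei Ej [D [m [sim srv enc En E1]]].
pose p : pnat := exist _ i i0; pose q : pnat := exist _ j j0.
pose u : update K sg := if b then Insert (ground (point x y p q) a) 1%R
                        else Delete (ground (point x y p q) a).
have Esv : update_svals u = if b then [:: 1%R] else [::] by rewrite /u; case: (b).
have enc' : encodes Q x y n (apply_update u D) (updP x y b P [:: a] i j).
  rewrite /u; case: (b); first exact: (encodes_insert hK hjoins neq_xy p q aQ enc).
  exact: (encodes_delete hjoins neq_xy p q aQ enc).
have Euw : update_words u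
         = nat_of_bool (~~ b) :: fact_words (ground (point x y p q) a).
  by rewrite /u; case: (b).
clearbody u.
have Ewords : map (operand_value mu) (atom_operands b a) = update_words u.
  rewrite Euw /= /fact_words /=; congr [:: _, _ & _].
  rewrite -!map_comp; apply: eq_map => z /=; rewrite ffunE.
  by case: eqP => // _; case: eqP.
have Bu : bounded_request word_limit (Update u).
  rewrite /bounded_request /= -Ewords /= all_map; apply/and3P; split.
  - by rewrite /word_limit; case: (b); lia.
  - by apply: ltnW; apply: leq_trans (ltn_ord _) _; rewrite /word_limit -addnA addnCA leq_addr.
  - apply/allP => o /mapP[z _ ->] /=; rewrite /word_limit.
    by case: eqP => [_ |_]; [|case: eqP]; rewrite /= ?Ei ?Ej; lia.
have [t [m' [Hh tc srv']]] := serves_update Bu srv.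
have -> : update_time a = size (atom_operands b a) + (1 + c).
  by rewrite /= size_map size_tuple /update_time; lia.
apply: wp_bind (wp_put _ _) _.
  move: Bu; rewrite /bounded_request /= -Ewords all_map.
  by apply: sub_all => o /= /leq_trans; apply.
move=> mu1; rewrite Ewords => E1'.
have same1 : same_caller mu mu1.
  by move=> b' i' b3; rewrite E1' ifN //; case: eqP => // E; move: b3; rewrite E.
have size_ops : size (atom_operands b a) = size (update_words u).
  by rewrite -Ewords size_map.
rewrite size_ops in E1'.
apply: (@wp_bind _ _ _ _ _ (fun mu2 => same_caller mu1 mu2 /\
     simulates mu2 (load (update_words u) (update_svals u) m))).
  have sb3 b' : (sbank b' == 3) = false by rewrite /sbank; lia.
  have M1 : 1 <= M by move: M_big; rewrite /word_limit; lia.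
  rewrite Esv; case: (b).
    apply: wp_const => //; split.
      by move=> b' i' b3; rewrite /= xpair_eqE; case: eqP => // E; move: b3; rewrite E.
    apply: (simulates_load (mu := mu) sim).
    - move=> b' i'; rewrite /wset [wmem _ _ _]/= xpair_eqE wbank_neq_sbank /= E1'.
      by rewrite (wbank_inj b' 0) leq0n add0n subn0.
    - move=> b' i'; rewrite /wset [wmem _ _ _]/= xpair_eqE (sbank_inj b' 0).
      rewrite E1' sb3.
      by case: eqP => //= _; case: i' => //=; rewrite oner_neq0.
    - by case=> [|i'] /=; rewrite ?nth_nil; constructor.
  apply: wp_weaken (wp_skip _ _) _ _; [|done|by move=> mu' H; exact: H].
  split=> //; apply: (simulates_load (mu := mu) sim).
  - by move=> b' i'; rewrite E1' (wbank_inj b' 0) leq0n add0n subn0.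
  - by move=> b' i'; rewrite andbF E1' sb3.
  - by move=> i'; rewrite nth_nil; constructor.
move=> mu2 [same2 sim2].
apply: wp_weaken (wp_call hK _ (leqnn M) sim2 Hh) tc _.
  by move: M_big; rewrite /word_limit; lia.
move=> mu3 [sim3 same3].
have same : same_caller mu mu3.
  exact: same_caller_trans same1 (same_caller_trans same2 same3).
split=> //; exists (apply_update u D), m'; split=> //; rewrite ?same //.
Qed.

(** An update restarts the enumeration, whereas an empty list of updates leaves it where it was. *)
Definition seen_after L seen := if L is [::] then seen else [::].

Lemma wp_updates b L i j k P seen mu :
  {subset L <= cq_rels Q} -> 0 < i <= n -> 0 < j <= n ->
  wmem mu 2 1 = i -> wmem mu 2 2 = j -> state (size L + k) P seen mu ->
  wp M (update_cmds b L) (updates_time L) (fun mu' => same_caller mu mu' /\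
    state k (updP x y b P L i j) (seen_after L seen) mu') mu.
Proof.
elim: L P seen mu => [|a L IH] P seen mu LQ Hi Hj Ei Ej st.
  by apply: wp_skip; split.
have aQ : a \in cq_rels Q by apply: LQ; rewrite mem_head.
apply: wp_bind (wp_update b aQ Hi Hj Ei Ej st) _ => mu1 [same1 st1].
apply: wp_weaken (IH _ _ _ _ Hi Hj _ _ st1) (leqnn _) _.
- by move=> a' a'L; apply: LQ; rewrite inE a'L orbT.
- by rewrite same1.
- by rewrite same1.
move=> mu2 [same2 st2]; split; first exact: same_caller_trans same1 same2.
rewrite (_ : seen_after (a :: L) seen = seen_after L [::]); last by case: (L).
apply: state_ext st2 => a' i' j' _; rewrite /updP /hit !inE.
by case: (a' == a); case: (a' \in L); case: (coord x _ _ == _);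
  case: (coord y _ _ == _).
Qed.

Lemma wp_next k P seen mu :
  boundedP Q x y n P -> state k.+1 P seen mu ->
  wp M (Call (dyn_next A)) c (fun mu' => same_caller mu mu' /\
    ([/\ wmem mu' (wbank 1) 0 = 0, (forall d, answer x y n P d -> d \in seen) &
         state k P seen mu'] \/
     exists d, [/\ d \notin seen, answer x y n P d, wmem mu' (wbank 1) 0 <> 0,
       forall i : 'I_(size (cq_head Q)), wmem mu' (wbank 1) i.+1 = val (tnth d i) &
       state k P (d :: seen) mu'])) mu.
Proof.
move=> bP [D [m [sim srv enc En E1]]].
have [t [m' [Hh tc H]]] := serves_next srv.
apply: wp_weaken (wp_call hK _ (leqnn M) sim Hh) tc _.
  by move: M_big; rewrite /word_limit; lia.
move=> mu' [sim' same']; split=> //; have [Ew _ _] := sim'.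
case: H => [[H1 H2 H3]|[d [H1 H2 [H3 H4 _] H5]]]; [left|right].
  split; rewrite ?Ew //.
    by move=> d /(query_valueP hK d n_gt0 bP enc); exact: H2.
  by exists D, m'; split; rewrite ?same'.
exists d; split; rewrite ?Ew //.
- exact/(query_valueP hK d n_gt0 bP enc).
- by move=> i; rewrite Ew H4.
- by exists D, m'; split; rewrite ?same'.
Qed.

Lemma state_wset k P seen mu l v :
  (address mu l).1 < 3 -> address mu l != (2, 0) -> address mu l != (2, 4) ->
  state k P seen mu -> state k P seen (wset mu l v).
Proof.
move=> lt3 n0 n4; apply: state_frame.
- move=> b i b2; rewrite /= ifN //; apply: contraTneq lt3 => <- /=.
  by rewrite -leqNgt.
- by rewrite /= eq_sym (negPf n0).
- by rewrite /= eq_sym (negPf n4).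
Qed.

Definition class_atoms (bx by_ : bool) : seq (ratom sg V) :=
  [seq a : ratom sg V <- cq_rels Q | ((x \in tagged a) == bx) && ((y \in tagged a) == by_)].

(** Atoms fall into four classes according to which of x and y they mention: [alpha] is the matrix,
    [beta] the vector, [gamma] the selected rows, and [eps] tells whether the atoms with neither
    variable hold their all-ones fact. *)
Definition class_pred (alpha : nat -> nat -> bool) (beta gamma : nat -> bool)
    (eps : bool) a (i j : nat) : bool :=
  if x \in tagged a then if y \in tagged a then alpha i j else gamma i
  else if y \in tagged a then beta j else eps.

Lemma state_class_ext k al al' be be' ga ga' e seen mu :
  al =2 al' -> be =1 be' -> ga =1 ga' ->
  state k (class_pred al be ga e) seen mu -> state k (class_pred al' be' ga' e) seen mu.
Proof.
move=> E1 E2 E3; apply: state_ext => a i j _; rewrite /class_pred.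
by rewrite E1 E2 E3.
Qed.

Definition override (f : nat -> bool) (i : nat) (b : bool) : nat -> bool :=
  fun i' => if i' == i then b else f i'.

Definition override2 (f : nat -> nat -> bool) (i j : nat) (b : bool) :
    nat -> nat -> bool :=
  fun i' j' => if (i' == i) && (j' == j) then b else f i' j'.

Section Classes.
Variables (b bx by_ : bool) (i j k : nat) (mu : memory nat).
Variables (alpha : nat -> nat -> bool) (beta gamma : nat -> bool) (eps : bool).
Variable seen : seq ((size (cq_head Q)).-tuple pnat).
Hypothesis i_bnd : 0 < i <= n.
Hypothesis j_bnd : 0 < j <= n.
Hypothesis mu_i : wmem mu 2 1 = i.
Hypothesis mu_j : wmem mu 2 2 = j.
Hypothesis st : state (size (class_atoms bx by_) + k)
                      (class_pred alpha beta gamma eps) seen mu.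

Lemma wp_class_updates :
  wp M (update_cmds b (class_atoms bx by_)) (updates_time (class_atoms bx by_))
    (fun mu' => same_caller mu mu' /\
       state k (class_pred (if bx && by_ then override2 alpha i j b else alpha)
                           (if ~~ bx && by_ then override beta j b else beta)
                           (if bx && ~~ by_ then override gamma i b else gamma)
                           (if ~~ bx && ~~ by_ then b else eps))
         (seen_after (class_atoms bx by_) seen) mu') mu.
Proof.
apply: wp_weaken (wp_updates b _ i_bnd j_bnd mu_i mu_j st) (leqnn _) _.
  by move=> a; rewrite mem_filter => /andP[].
move=> mu' [same st']; split=> //; apply: state_ext st' => a i' j' aQ.
rewrite /updP /hit mem_filter aQ andbT /class_pred /coord.
by case: (x \in _); case: (y \in _); case: (bx); case: (by_) => //=; rewrite andbT.
Qed.

End Classes.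

(** ** Preprocessing *)

(** The leading 0 is the number of facts: the preprocessing receives the empty database. *)
Definition cst_operands : seq operand :=
  inl 0 :: [seq if covered_cst Q e then inr 0 else inl 1 | e <- enum (cst sg)].

Definition cell_cmd : cmd :=
  Seq (Op Sub (reg 3) (reg 1) (reg 4))
  (Seq (Op Mul (reg 3) (reg 3) (reg 0))
  (Seq (Op Add (reg 3) (reg 3) (reg 2))
       (When (Ind 0 2 3) (update_cmds true (class_atoms true true))))).

Definition matrix_cmd : cmd := for_loop 1 (for_loop 2 cell_cmd).

Definition matrix_time : nat :=
  (n * (n * ((updates_time (class_atoms true true)).+4).+3).+2.+3).+2.

Variable alpha : nat -> nat -> bool.
Hypothesis alphaP : forall i j, alpha i j -> 0 < i <= n /\ 0 < j <= n.

(** The input is n followed by the entries row by row. With indices counted from 1, entry (i, j) is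
    in cell (i - 1) n + j, as the leading n makes up for the 1 in j - 1. *)
Definition stores_matrix mu : Prop :=
  forall i j, 0 < i <= n -> 0 < j <= n -> wmem mu 0 (i.-1 * n + j) = alpha i j.

Lemma stores_matrix_same mu mu' :
  (forall i, wmem mu' 0 i = wmem mu 0 i) -> stores_matrix mu -> stores_matrix mu'.
Proof. by move=> E H i j Hi Hj; rewrite E H. Qed.

Lemma wp_matrix k mu :
  stores_matrix mu ->
  state (n * (n * size (class_atoms true true)) + k)
        (class_pred (fun _ _ => false) (fun _ => false) (fun _ => false) true) [::] mu ->
  wp M matrix_cmd matrix_time (state k
    (class_pred alpha (fun _ => false) (fun _ => false) true) [::]) mu.
Proof.
move=> mx st.
set z := size (class_atoms true true) in st *.
(* [h] marks the cells already visited; as the loops count down, these are the lexicographically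
   later ones. *)
pose F (h : nat -> nat -> bool) :=
  class_pred (fun i j => h i j && alpha i j) (fun _ => false) (fun _ => false) true.
have nM : n <= M by apply: leq_trans M_sqr; rewrite leq_addl.
have En : wmem mu 2 0 = n by case: st => [D [m []]].
pose I i mu' := [/\ wmem mu' 2 1 = i, stores_matrix mu' &
  state (i * (n * z) + k) (F (fun i' _ => i < i')) [::] mu'].
apply: (@wp_weaken _ _ (n * (n * ((updates_time (class_atoms true true)).+4).+3).+2.+3).+2
  _ (I 0)) => //; last first.
  move=> mu' [_ _]; rewrite mul0n add0n; apply: state_class_ext => // i j.
  by case: (boolP (alpha i j)) => [/alphaP[/andP[->]]|]; rewrite ?andbF.
apply: wp_for => //; first by move=> i mu' [].
  move=> i mu1 lt_in [E1 mx1 st1].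
  have En1 : wmem mu1 2 0 = n by case: st1 => [D [m []]].
  pose J j mu' := [/\ wmem mu' 2 2 = j, wmem mu' 2 1 = i.+1, stores_matrix mu' &
    state (j * z + (i * (n * z) + k))
      (F (fun i' j' => (i.+1 < i') || (i' == i.+1) && (j < j'))) [::] mu'].
  apply: (@wp_weaken _ _ (n * ((updates_time (class_atoms true true)).+4).+3).+2
    _ (J 0)) => //; last first.
    move=> mu' [_ E1' mx' st'].
    split=> //; first by case: st' => [D [m []]].
    split=> //.
    apply: state_wset => //; apply: state_class_ext st' => // i' j'.
    by case: (boolP (alpha i' j')) => [/alphaP[]|_]; rewrite ?andbF // !andbT; lia.
  apply: wp_for => //; first by move=> j mu' [].
    move=> j mu2 lt_jn [E2 E1' mx2 st2].
    have [En2 Eone] : wmem mu2 2 0 = n /\ wmem mu2 2 4 = 1 by case: st2 => [D [m []]].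
    apply: (wp_seq (T1 := 1) (T2 := (updates_time _).+3)).
    apply: (@wp_op _ _ _ _ _ i).
    - by rewrite /wget /= E1' Eone subn1.
    - by apply: ltnW; apply: leq_trans nM.
    apply: (wp_seq (T1 := 1) (T2 := (updates_time _).+2)).
    apply: (@wp_op _ _ _ _ _ (i * n)).
    - by rewrite /wget /= En2.
    - by apply: leq_trans M_sqr; nia.
    apply: (wp_seq (T1 := 1) (T2 := (updates_time _).+1)).
    apply: (@wp_op _ _ _ _ _ (i * n + j.+1)).
    - by rewrite /wget /= E2.
    - by apply: leq_trans M_sqr; nia.
    set mu3 := wset _ (reg 3) (i * n + j.+1).
    have Hi : 0 < i.+1 <= n by rewrite lt_in.
    have Hj : 0 < j.+1 <= n by rewrite lt_jn.
    have Ecell : wget mu3 (Ind 0 2 3) = alpha i.+1 j.+1 by rewrite -(mx2 _ _ Hi Hj).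
    have st3 : state (z + (j * z + (i * (n * z) + k)))
        (F (fun i' j' => (i.+1 < i') || (i' == i.+1) && (j.+1 < j'))) [::] mu3.
      by do 3!apply: state_wset => //; rewrite addnA -mulSn.
    apply: wp_when => [E0|N0].
      split=> //; split=> //.
      (* A zero entry needs no insertion, and the requests reserved for it are given up. *)
      apply: state_wset => //; apply: state_class_ext (state_le (leq_addl _ _) st3) => // i' j'.
      case: (boolP (alpha i' j')) => al; rewrite ?andbF ?andbT //.
      suff : ~~ ((i' == i.+1) && (j' == j.+1)) by lia.
      by apply/negP => /andP[/eqP Ei /eqP Ej]; move: E0; rewrite Ecell -Ei -Ej al.
    have al : alpha i.+1 j.+1 by move: N0; rewrite Ecell; case: (alpha _ _).
    apply: wp_weaken (wp_class_updates true Hi Hj _ _ st3) (leqnn _) _ => //.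
    move=> mu4 [same4 st4]; split; rewrite ?same4 //; split; rewrite ?same4 //.
      by rewrite /= same4.
      by apply: stores_matrix_same mx2 => i'; rewrite /= same4.
    apply: state_wset => //.
    rewrite (_ : seen_after _ _ = [::]) in st4; last by rewrite /seen_after; case: class_atoms.
    apply: state_class_ext st4 => // i' j'; rewrite /override2 /=.
    case: (i' =P i.+1) => [->|/eqP Ni] /=; last by [].
    case: (j' =P j.+1) => [->|/eqP Nj] /=; first by rewrite al ltnSn orbT.
    by congr (_ && _); lia.
  split=> //; apply: state_wset => //.
  rewrite mulSn -addnA in st1; apply: state_class_ext st1 => // i' j'.
  by case: (boolP (alpha i' j')) => [/alphaP[]|_]; rewrite ?andbF // !andbT; lia.
split=> //; apply: state_wset => //; apply: state_class_ext st => // i j.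
by case: (boolP (alpha i j)) => [/alphaP[]|_]; rewrite ?andbF // !andbT; lia.
Qed.
Definition preprocess_cmd : cmd :=
  Seq (Const (reg 4) 1)
  (Seq (Op Or (reg 0) (Dir 0 0) (Dir 0 0))
  (Seq (put 0 cst_operands)
  (Seq (Call (dyn_preprocess A))
  (Seq (Const (reg 1) 1)
  (Seq (Const (reg 2) 1)
  (Seq (update_cmds true (class_atoms false false))
       matrix_cmd)))))).

Definition preprocess_time : nat :=
  1 + (1 + (size cst_operands + (c + (1 + (1 +
    (updates_time (class_atoms false false) + matrix_time)))))).

Lemma wp_preprocess k mu D t m :
  (forall e, val (db_cst D e) = cst_value Q n e) ->
  (forall f, db_rel D f = 0%R) ->
  halts_in M (dyn_preprocess A) (load (db_words D [::]) [::] (memory0 K)) t m ->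
  t <= c ->
  serves A c M word_limit (size (class_atoms false false) +
    (n * (n * size (class_atoms true true)) + k)) D
    ([::] : seq ((size (cq_head Q)).-tuple pnat)) m ->
  wmem mu 0 0 = n -> (forall b i, 0 < b -> wmem mu b i = 0) -> stores_matrix mu ->
  wp M preprocess_cmd preprocess_time (state k
    (class_pred alpha (fun _ => false) (fun _ => false) true) [::]) mu.
Proof.
move=> Hcst Hrel Hh tc srv E0 Ez mx.
have nM : n <= M by apply: leq_trans M_sqr; rewrite leq_addl.
have M1 : 1 <= M by apply: leq_trans nM.
apply: wp_seq; apply: wp_const => //.
apply: wp_seq; apply: (@wp_op _ _ _ _ _ n) => //.
  by rewrite /wget /= E0 PeanoNat.Nat.lor_diag.
set mu1 := wset _ (reg 0) n.
have Ewords : map (operand_value mu1) cst_operands = db_words D [::].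
  rewrite /cst_operands /db_words /= cats0 -map_comp; congr cons.
  by apply: eq_map => e /=; rewrite Hcst /cst_value; case: ifP.
apply: wp_bind (wp_put _ _) _.
  apply/allP => o; rewrite inE => /orP[/eqP->//|/mapP[e _ ->]].
  by case: ifP.
move=> mu2 E2; rewrite Ewords in E2.
have same2 : same_caller mu1 mu2.
  by move=> b' i' b3; rewrite E2 ifN //; case: eqP => // E; move: b3; rewrite E.
have size_ops : size cst_operands = size (db_words D [::]).
  by rewrite -Ewords size_map.
rewrite size_ops in E2.
have sim1 : simulates mu1 (memory0 K).
  split=> [b i|b i|b i]; rewrite /= ?eqxx ?Ez //; last by constructor.
have sim2 : simulates mu2 (load (db_words D [::]) [::] (memory0 K)).
  apply: (simulates_load sim1).
  - by move=> b' i'; rewrite E2 (wbank_inj b' 0) leq0n add0n subn0.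
  - have sb3 b' : (sbank b' == 3) = false by rewrite /sbank; lia.
    by move=> b' i'; rewrite andbF E2 sb3.
  - by move=> i'; rewrite nth_nil; constructor.
apply: wp_bind (wp_weaken (wp_call hK M1 (leqnn M) sim2 Hh) tc (fun _ H => H)) _.
move=> mu3 [sim3 same3].
have same13 : same_caller mu1 mu3 by exact: same_caller_trans same2 same3.
have st3 : state (size (class_atoms false false) +
    (n * (n * size (class_atoms true true)) + k))
    (class_pred (fun _ _ => false) (fun _ => false) (fun _ => false) false) [::] mu3.
  exists D, m; split=> //; try by rewrite same13.
  split=> // a nu aQ; rewrite /eval_ratom Hrel eqxx; split; first by constructor.
  by rewrite /holds /class_pred; do 2!case: ifP => _; rewrite andbF.
(* The atoms inserted next mention neither x nor y; the value 1 is chosen to lie in the range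
   required of both registers. *)
apply: wp_seq; apply: wp_const => //; apply: wp_seq; apply: wp_const => //.
set mu4 := wset _ (reg 2) 1.
have st4 := @state_wset _ _ _ _ (reg 2) 1 isT isT isT
  (@state_wset _ _ _ _ (reg 1) 1 isT isT isT st3).
have H1 : 0 < 1 <= n by rewrite n_gt0.
apply: wp_bind (wp_class_updates true H1 H1 _ _ st4) _ => // mu5 [same5 st5].
apply: wp_matrix.
  by apply: stores_matrix_same mx => i; rewrite same5 //= same13.
by move: st5; rewrite /= (_ : seen_after _ _ = [::]) //= /seen_after; case: class_atoms.
Qed.

(** ** Rounds *)

(** Deleting before inserting removes what the previous round left in entry j. The same pass clears
    output cell j - 1, since the row phase writes only ones. *)
Definition column_cmd : cmd :=
  Seq (Op Sub (reg 3) (reg 2) (reg 4))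
  (Seq (Const (Ind 1 2 3) 0)
  (Seq (update_cmds false (class_atoms false true))
       (When (Ind 0 2 3) (update_cmds true (class_atoms false true))))).

Definition vector_cmd : cmd := Seq (Const (reg 1) 1) (for_loop 2 column_cmd).

Definition column_time : nat :=
  1 + (1 + (updates_time (class_atoms false true) +
            (updates_time (class_atoms false true)).+1)).

Definition vector_time : nat := 1 + (n * column_time.+3).+2.

Hypothesis y_atoms : class_atoms false true != [::].

(** As some atom mentions y but not x, a round performs at least one update, which restarts the
    enumeration: hence the empty list of seen answers in the conclusion. *)
Lemma wp_vector (vec beta : nat -> bool) k seen mu :
  (forall j, vec j -> 0 < j <= n) -> (forall j, beta j -> 0 < j <= n) ->
  (forall j, 0 < j <= n -> wmem mu 0 j.-1 = vec j) ->
  state (n * (size (class_atoms false true)).*2 + k)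
        (class_pred alpha beta (fun _ => false) true) seen mu ->
  wp M vector_cmd vector_time (fun mu' =>
    state k (class_pred alpha vec (fun _ => false) true) [::] mu' /\
    (forall j, 0 < j <= n -> wmem mu' 1 j.-1 = 0)) mu.
Proof.
move=> vecP betaP vmem st.
set z := size (class_atoms false true) in st *.
have nM : n <= M by apply: leq_trans M_sqr; rewrite leq_addl.
have M1 : 1 <= M by apply: leq_trans nM.
have En : wmem mu 2 0 = n by case: st => [D [m []]].
(* Once a column has been treated, the counter is below n and the enumeration is fresh. *)
pose I j mu' := [/\ wmem mu' 2 2 = j, wmem mu' 2 1 = 1,
  forall j', 0 < j' <= n -> wmem mu' 0 j'.-1 = vec j',
  forall j', j < j' <= n -> wmem mu' 1 j'.-1 = 0 &
  exists2 s, (j < n -> s = [::]) & state (j * z.*2 + k)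
    (class_pred alpha (fun j' => if j < j' then vec j' else beta j')
       (fun _ => false) true) s mu'].
apply: wp_seq; apply: wp_const => //.
apply: (@wp_weaken _ _ (n * column_time.+3).+2 _ (I 0)) => //; last first.
  move=> mu' [_ _ _ H [s /(_ n_gt0) -> st']]; split=> //.
  apply: state_class_ext st' => // -[|j] //=.
  by case: (boolP (beta 0)) => [/betaP//|_]; case: (boolP (vec 0)) => [/vecP|].
apply: wp_for => //; first by move=> j mu' [].
  move=> j mu1 lt_jn [E2 E1 v1 o1 [s _ st1]].
  have Eone : wmem mu1 2 4 = 1 by case: st1 => [D [m []]].
  have H1 : 0 < 1 <= n by rewrite n_gt0.
  have Hj : 0 < j.+1 <= n by rewrite lt_jn.
  apply: wp_seq; apply: (@wp_op _ _ _ _ _ j).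
  - by rewrite /wget /= E2 Eone subn1.
  - by apply: ltnW; apply: leq_trans nM.
  apply: wp_seq; apply: wp_const => //.
  set mu2 := wset _ (Ind 1 2 3) 0.
  have st2 : state (z + (z + (j * z.*2 + k))) (class_pred alpha
      (fun j' => if j.+1 < j' then vec j' else beta j') (fun _ => false) true) s mu2.
    rewrite addnA addnn addnA -mulSn.
    by apply: state_wset; last (apply: state_wset; last exact: st1).
  have [E22 E21] : wmem mu2 2 2 = j.+1 /\ wmem mu2 2 1 = 1 by [].
  have v2 : forall j', 0 < j' <= n -> wmem mu2 0 j'.-1 = vec j' by [].
  have o2 : forall j', j < j' <= n -> wmem mu2 1 j'.-1 = 0.
    move=> j' /andP[lt_jj' le_j'n] /=; rewrite xpair_eqE /=.
    case: eqP => // N; apply: o1; rewrite le_j'n andbT ltn_neqAle lt_jj' andbT.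
    by apply/eqP => E; apply: N; rewrite -E.
  apply: wp_bind (wp_class_updates false H1 Hj E21 E22 st2) _ => // mu3 [same3 st3].
  rewrite (_ : seen_after _ _ = [::]) in st3; last first.
    by move: y_atoms; rewrite /seen_after; case: class_atoms.
  have Ev : wget mu3 (Ind 0 2 3) = vec j.+1.
    by rewrite /wget [address _ _]/= !same3 //; exact: (v2 _ Hj).
  apply: wp_when => [E0|N0].
    split; rewrite ?same3 //.
    split; rewrite /= ?same3 //.
    - by move=> j' Hj'; rewrite same3 // v2.
    - by move=> j' Hj'; rewrite same3 // o2.
    exists [::] => //; apply: state_wset => //.
    apply: state_class_ext (state_le (leq_addl _ _) st3) => // j'.
    rewrite /= /override; case: (ltngtP j j') => [lt|gt|<-].
    - case: eqP => [->|N]; first by move: E0; rewrite Ev; case: (vec _).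
      by rewrite (_ : j.+1 < j') //; lia.
    - by rewrite !ifN //; lia.
    - by rewrite !ifN //; lia.
  have vj : vec j.+1 by move: N0; rewrite Ev; case: (vec _).
  apply: wp_weaken (wp_class_updates true H1 Hj _ _ st3) (leqnn _) _;
    rewrite ?same3 //.
  move=> mu4 [same4 st4].
  have same : same_caller mu2 mu4 by exact: same_caller_trans same3 same4.
  split; rewrite ?same //.
  split; rewrite /= ?same //.
  - by move=> j' Hj'; rewrite same // v2.
  - by move=> j' Hj'; rewrite same // o2.
  exists [::] => //; apply: state_wset => //.
  rewrite (_ : seen_after _ _ = [::]) in st4; last by rewrite /seen_after; case: class_atoms.
  apply: state_class_ext st4 => // j'.
  rewrite /= /override; case: (ltngtP j j') => [lt|gt|<-].
  - by case: eqP => [->|N]; rewrite ?vj // (_ : j.+1 < j') //; lia.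
  - by rewrite !ifN //; lia.
  - by rewrite !ifN //; lia.
split=> //.
- by move=> j' /andP[/leq_trans H /H]; rewrite ltnn.
exists seen; rewrite ?ltnn //; do 2!apply: state_wset => //.
apply: state_class_ext st => // j'; case: ltnP => // lt.
by apply/idP/idP => [/betaP|/vecP]; lia.
Qed.

(** One program for both cases. If some atom mentions x but not y, row i is selected, probed and
    deselected, and [src] is the register of x; if none does, the updates are empty, the loop just
    asks n times for an answer, and [src] is the output word carrying the value of x. *)
Definition row_cmd (src : loc) : cmd :=
  Seq (update_cmds true (class_atoms true false))
  (Seq (Call (dyn_next A))
  (Seq (When (Dir (wbank 1) 0)
          (Seq (Op Sub (reg 3) src (reg 4)) (Const (Ind 1 2 3) 1)))
       (update_cmds false (class_atoms true false)))).

Definition rows_cmd src : cmd := Seq (Const (reg 2) 1) (for_loop 1 (row_cmd src)).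

Definition row_time : nat :=
  updates_time (class_atoms true false) +
  (c + (3 + updates_time (class_atoms true false))).

Definition rows_time : nat := 1 + (n * row_time.+3).+2.

Lemma boundedP_class (vec gamma : nat -> bool) eps :
  (forall j, vec j -> 0 < j <= n) -> (forall i, gamma i -> 0 < i <= n) ->
  boundedP Q x y n (class_pred alpha vec gamma eps).
Proof.
move=> vecP gammaP a i j _; rewrite /class_pred /coord.
case: (x \in _); case: (y \in _) => //.
- by move=> /alphaP[/andP[_ ->] /andP[_ ->]].
- by move=> /gammaP/andP[_ ->].
- by move=> /vecP/andP[_ ->].
Qed.

Section Rows.
Variables (vec product : nat -> bool).
Hypothesis vecP : forall j, vec j -> 0 < j <= n.

Notation row_pred gamma := (class_pred alpha vec gamma true).

Lemma wp_record src i k P seen mu :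
  wget mu src = i.+1 -> i < n -> state k P seen mu ->
  wp M (Seq (Op Sub (reg 3) src (reg 4)) (Const (Ind 1 2 3) 1)) 2 (fun mu' =>
    [/\ state k P seen mu', wmem mu' 2 1 = wmem mu 2 1, wmem mu' 2 2 = wmem mu 2 2 &
        forall i', wmem mu' 1 i' = if i' == i then 1 else wmem mu 1 i']) mu.
Proof.
move=> Es lt_in st; have Eone : wmem mu 2 4 = 1 by case: st => [D [m []]].
have nM : n <= M by apply: leq_trans M_sqr; rewrite leq_addl.
apply: (wp_seq (T1 := 1) (T2 := 1)); apply: (@wp_op _ _ _ _ _ i).
- by rewrite /= Es /wget /= Eone subn1.
- by apply: ltnW; apply: leq_trans nM.
apply: wp_const; first by apply: leq_trans nM.
split=> //; by do 2!apply: state_wset => //.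
Qed.

Lemma wp_rows_select k mu :
  class_atoms true false != [::] ->
  (forall i, 0 < i <= n ->
     (exists d, answer (Q := Q) x y n (row_pred (override (fun _ => false) i true)) d)
     <-> product i) ->
  (forall i, 0 < i <= n -> wmem mu 1 i.-1 = 0) ->
  state (n * (size (class_atoms true false)).*2.+1 + k)
        (row_pred (fun _ => false)) [::] mu ->
  wp M (rows_cmd (reg 1)) rows_time (fun mu' =>
    (exists s, state k (row_pred (fun _ => false)) s mu') /\
    (forall i, 0 < i <= n -> wmem mu' 1 i.-1 = product i)) mu.
Proof.
move=> x_atoms Hans out0 st.
set z := size (class_atoms true false) in st *.
have nM : n <= M by apply: leq_trans M_sqr; rewrite leq_addl.
have M1 : 1 <= M by apply: leq_trans nM.
have En : wmem mu 2 0 = n by case: st => [D [m []]].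
pose I i mu' := [/\ wmem mu' 2 1 = i, wmem mu' 2 2 = 1,
  forall i', 0 < i' <= n -> wmem mu' 1 i'.-1 = (i < i') && product i' &
  exists s, state (i * z.*2.+1 + k) (row_pred (fun _ => false)) s mu'].
apply: wp_seq; apply: wp_const => //.
apply: (@wp_weaken _ _ (n * row_time.+3).+2 _ (I 0)) => //; last first.
  move=> mu' [_ _ H [s st']]; split; first by exists s.
  by move=> i Hi; rewrite H //; case/andP: Hi => ->.
apply: wp_for => //; first by move=> i mu' [].
  move=> i mu1 lt_in [E1 E2 o1 [s st1]].
  have H1 : 0 < 1 <= n by rewrite n_gt0.
  have Hi : 0 < i.+1 <= n by rewrite lt_in.
  have {}st1 : state (z + (z + (i * z.*2.+1 + k)).+1) (row_pred (fun _ => false)) s mu1.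
    by apply: state_le st1; rewrite mulSn; lia.
  apply: wp_bind (wp_class_updates true Hi H1 E1 E2 st1) _ => mu2 [same2 st2].
  rewrite (_ : seen_after _ _ = [::]) in st2; last first.
    by move: x_atoms; rewrite /seen_after; case: class_atoms.
  rewrite /= in st2.
  have bP : boundedP Q x y n (row_pred (override (fun _ => false) i.+1 true)).
    by apply: boundedP_class => // i'; rewrite /override; case: eqP => // ->.
  apply: wp_bind (wp_next bP st2) _ => mu3 [same3 H3].
  have same13 := same_caller_trans same2 same3.
  apply: (@wp_bind _ _ _ _ _ (fun mu4 => [/\ exists s, state (z + (i * z.*2.+1 + k))
      (row_pred (override (fun _ => false) i.+1 true)) s mu4,
      wmem mu4 2 1 = i.+1, wmem mu4 2 2 = 1 &
      forall i', 0 < i' <= n -> wmem mu4 1 i'.-1 = (i < i') && product i'])).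
    have o3 b : (product i.+1 = b) -> forall i', 0 < i' <= n ->
        (if i'.-1 == i then b : nat else wmem mu1 1 i'.-1) = (i < i') && product i'.
      move=> Eb i' Hi'; rewrite o1 //; case: eqP => [E|N].
        have -> : i' = i.+1 by lia.
        by rewrite ltnSn Eb.
      by have -> : (i.+1 < i') = (i < i') by lia.
    case: H3 => [[H31 H32 H33]|[d [_ H31 H32 _ H33]]].
      (* After an update nothing has been seen, so a refusal means that there is no answer at
         all. *)
      have Np : product i.+1 = false.
        by apply/negP => /(Hans _ Hi)[d /H32]; rewrite in_nil.
      apply: wp_when => // _; split; rewrite ?same13 //; first by exists [::].
      move=> i' Hi'; rewrite -(o3 _ Np) // same13 //.
      by case: eqP => // E; rewrite o1 // (_ : i' = i.+1) ?ltnn //; lia.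
    have Yp : product i.+1 = true by apply/(Hans _ Hi); exists d.
    apply: wp_when => // _.
    have Es : wget mu3 (reg 1) = i.+1 by rewrite /wget /= same13.
    apply: wp_weaken (wp_record Es lt_in H33) (leqnn _) _.
    move=> mu4 [st4 E41 E42 o4]; split; rewrite ?E41 ?E42 ?same13 //; first by eexists; exact: st4.
    by move=> i' Hi'; rewrite -(o3 _ Yp) // o4 same13.
  move=> mu4 [[s4 st4] E41 E42 o4].
  apply: wp_weaken (wp_class_updates false Hi H1 E41 E42 st4) (leqnn _) _.
  move=> mu5 [same5 st5]; split; rewrite ?same5 //; first by case: st4 => [D [m []]].
  split; rewrite /= ?same5 //; first by move=> i' Hi'; rewrite same5 // o4.
  eexists; apply: state_wset => //; apply: state_class_ext st5 => // i' /=.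
  by rewrite /override; case: eqP.
split=> //; last by exists [::]; do 2!apply: state_wset => //.
by move=> i' Hi'; rewrite /= out0 //; case: ltnP => // lt; lia.
Qed.

(* There are at most n answers, so that n requests exhaust them. *)
Lemma wp_rows_enumerate (ix : 'I_(size (cq_head Q))) k mu
    (row := fun d : (size (cq_head Q)).-tuple pnat => val (tnth d ix)) :
  class_atoms true false = [::] ->
  (forall d, answer (Q := Q) x y n (row_pred (fun _ => false)) d -> product (row d)) ->
  (forall d d', answer (Q := Q) x y n (row_pred (fun _ => false)) d ->
     answer (Q := Q) x y n (row_pred (fun _ => false)) d' -> row d = row d' -> d = d') ->
  (forall i, product i -> 0 < i <= n /\
     exists2 d, answer (Q := Q) x y n (row_pred (fun _ => false)) d & row d = i) ->
  (forall i, 0 < i <= n -> wmem mu 1 i.-1 = 0) ->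
  state (n + k) (row_pred (fun _ => false)) [::] mu ->
  wp M (rows_cmd (Dir (wbank 1) ix.+1)) rows_time (fun mu' =>
    (exists s, state k (row_pred (fun _ => false)) s mu') /\
    (forall i, 0 < i <= n -> wmem mu' 1 i.-1 = product i)) mu.
Proof.
move=> x_atoms ans_row ans_inj row_ans out0 st.
have nM : n <= M by apply: leq_trans M_sqr; rewrite leq_addl.
have M1 : 1 <= M by apply: leq_trans nM.
have En : wmem mu 2 0 = n by case: st => [D [m []]].
(* Either the answers are exhausted, or every turn so far has produced a new one. *)
pose I i mu' := [/\ wmem mu' 2 1 = i, i <= n & exists s,
  [/\ uniq s, forall d, d \in s -> answer (Q := Q) x y n (row_pred (fun _ => false)) d,
      (forall d, answer (Q := Q) x y n (row_pred (fun _ => false)) d -> d \in s)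
      \/ size s = n - i,
      forall i', 0 < i' <= n -> wmem mu' 1 i'.-1 = (i' \in map row s) &
      state (i + k) (row_pred (fun _ => false)) s mu']].
apply: wp_seq; apply: wp_const => //.
apply: (@wp_weaken _ _ (n * row_time.+3).+2 _ (I 0)) => //; last first.
  move=> mu' [_ _ [s [us sa full out st']]]; split; first by exists s.
  move=> i Hi; rewrite out //; congr nat_of_bool; apply/idP/idP.
    by move=> /mapP[d /sa/ans_row H ->].
  move=> pi; case: full => [full|size_s].
    by have [_ [d /full ds <-]] := row_ans _ pi; exact: map_f.
  (* Otherwise n distinct rows among 1, ..., n were seen, hence all of them, by the pigeonhole
     principle. *)
  have ur : uniq (map row s).
    by rewrite map_inj_in_uniq // => d d' /sa ad /sa ad'; exact: ans_inj.
  have sub : {subset map row s <= iota 1 n}.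
    move=> _ /mapP[d /sa/ans_row/row_ans[Hd _] ->].
    by rewrite mem_iota add1n ltnS.
  have [|_ Emem] := uniq_min_size ur sub.
    by rewrite size_map size_s subn0 size_iota.
  by rewrite Emem mem_iota add1n ltnS.
apply: wp_for => //; first by move=> i mu' [].
  move=> i mu1 lt_in [E1 _ [s [us sa full out st1]]].
  rewrite addSn in st1.
  rewrite /row_cmd /row_time x_atoms [updates_time _]/= [update_cmds _ _]/=.
  rewrite [update_cmds _ _]/=.
  apply: wp_seq; apply: wp_skip.
  have bP : boundedP Q x y n (row_pred (fun _ => false)) by exact: boundedP_class.
  apply: wp_bind (wp_next bP st1) _ => mu2 [same2 H2].
  apply: wp_seq.
  case: H2 => [[H21 H22 H23]|[d [H21 H22 H23 H24 H25]]].
    apply: wp_when => // _; apply: wp_skip; split; rewrite ?same2 //.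
      by case: st1 => [D [m []]].
    split=> //; first exact: ltnW.
    exists s; split=> //; first by left.
    by move=> i' Hi'; rewrite /= same2 // out.
  have [Hd _] := row_ans _ (ans_row _ H22).
  have Hd0 : row d = (row d).-1.+1 by case/andP: Hd; case: (row d).
  apply: wp_when => // _.
  have Es : wget mu2 (Dir (wbank 1) ix.+1) = (row d).-1.+1.
    by rewrite -Hd0 /wget /= H24.
  have lt_rn : (row d).-1 < n by rewrite -Hd0; case/andP: Hd.
  apply: wp_weaken (wp_record Es lt_rn H25) (leqnn _) _.
  move=> mu3 [st3 E31 E32 o3]; apply: wp_skip; split.
  - by rewrite E31 same2.
  - by case: st3 => [D [m []]].
  split=> //; first exact: ltnW.
  exists (d :: s); split.
  - by rewrite /= H21.
  - by move=> d'; rewrite inE => /orP[/eqP->|/sa].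
  - case: full => [full|size_s]; [left=> d' ad'|right].
      by rewrite inE full ?orbT.
    by rewrite /= size_s; lia.
  - move=> i' Hi'; rewrite /= o3 same2 // out // inE.
    have -> : (i'.-1 == (row d).-1) = (i' == row d) by lia.
    by case: ifP.
  - by apply: state_wset.
split=> //; exists [::]; split=> //.
by right; rewrite subnn.
Qed.

End Rows.
End Fixed.
End Reduction.

(** * Answers of the query on an encoded matrix and vector *)

Section Answers.
Variables (sg : vocabulary) (V : finType) (Q : cq sg V) (x y : V) (n : nat).
Variables (alpha : nat -> nat -> bool) (vec gamma : nat -> bool).
Hypothesis hdisj : constant_disjoint Q.
Hypothesis neq_xy : x != y.
Hypothesis n_gt0 : 0 < n.
Hypothesis alphaP : forall i j, alpha i j -> 0 < i <= n /\ 0 < j <= n.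
Variables (axy ay : ratom sg V).
Hypothesis axyQ : axy \in cq_rels Q.
Hypothesis x_axy : x \in tagged axy.
Hypothesis y_axy : y \in tagged axy.
Hypothesis ayQ : ay \in cq_rels Q.
Hypothesis x_ay : x \notin tagged ay.
Hypothesis y_ay : y \in tagged ay.
Implicit Types (nu : {ffun V -> pnat}) (a : ratom sg V).

Notation P := (class_pred x y alpha vec gamma true).

Definition product i : bool := [exists j : 'I_n, alpha i j.+1 && vec j.+1].

Lemma productP i : reflect (exists2 j, alpha i j & vec j) (product i).
Proof.
apply: (iffP existsP) => [[j /andP[H1 H2]]|[j H1 H2]]; first by exists j.+1.
have [_ /andP[j0 jn]] := alphaP H1.
have lt : j.-1 < n by rewrite prednK.
by exists (Ordinal lt); rewrite /= prednK // H1.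
Qed.

Lemma coveredP (z : V) a : a \in cq_rels Q -> z \in tagged a -> covered Q z.
Proof. by move=> aQ za; apply/set0Pn; exists a; rewrite inE aQ. Qed.

Lemma satisfies_point (p q : pnat) :
  alpha (val p) (val q) -> vec (val q) ->
  (forall a, a \in cq_rels Q -> x \in tagged a -> y \notin tagged a -> gamma (val p)) ->
  satisfies Q x y n P (point x y p q).
Proof.
move=> al ve ga; have [/andP[_ pn] /andP[_ qn]] := alphaP al.
apply/andP; split; apply/allP.
  move=> a aQ; rewrite /holds point_x point_y //; apply/andP; split.
    by apply/allP => z _; rewrite ffunE; case: eqP => //= _; case: eqP.
  rewrite /class_pred /coord; case: ifP => xa; case: ifP => ya; rewrite ?xa ?ya //.
  by apply: (ga _ aQ xa); rewrite ya.
move=> [z e] ze /=; rewrite ffunE /cst_value.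
have cov a z' : (z', e) \in cq_cmps Q -> a \in cq_rels Q -> z' \in tagged a ->
    covered_cst Q e.
  by move=> z'e aQ z'a; apply/existsP; exists z'; rewrite z'e (coveredP aQ z'a).
case: eqP => [Ez|_]; first by rewrite (cov axy x) -?Ez // Ez.
case: eqP => [Ez|_]; first by rewrite (cov axy y) -?Ez // Ez.
by case: ifP.
Qed.

Lemma satisfies_inv nu : satisfies Q x y n P nu ->
  [/\ alpha (val (nu x)) (val (nu y)), vec (val (nu y)) &
      forall a, a \in cq_rels Q -> x \in tagged a -> y \notin tagged a ->
      gamma (val (nu x))].
Proof.
move=> /andP[/allP H _]; split.
- by have /andP[_] := H _ axyQ; rewrite /class_pred /coord x_axy y_axy.
- by have /andP[_] := H _ ayQ; rewrite /class_pred /coord (negPf x_ay) y_ay.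
move=> a aQ xa ya; have /andP[_] := H _ aQ.
by rewrite /class_pred /coord xa (negPf ya).
Qed.

(** A free variable that no relational atom mentions is bounded by a constant that, by
    constant-disjointness, bounds no covered variable; such a constant has value 1. *)
Lemma satisfies_other nu z : satisfies Q x y n P nu -> free Q z ->
  z != x -> z != y -> nu z = pone.
Proof.
move=> /andP[/allP Hr /allP Hc] fz zx zy; apply: val_inj => /=.
have [[a aQ za]|[e ze]] := cq_vars Q z.
  have /andP[/allP /(_ _ za)] := Hr _ aQ.
  by rewrite (negPf zx) (negPf zy) /= => /eqP.
case: (boolP (covered Q z)) => [/set0Pn[a]|ncz].
  rewrite inE => /andP[aQ za]; have /andP[/allP /(_ _ za)] := Hr _ aQ.
  by rewrite (negPf zx) (negPf zy) /= => /eqP.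
have := Hc _ ze; rewrite /= /cst_value ifN.
  by have := valP (nu z); rewrite /=; case: (sval (nu z)) => [|[|]].
apply/existsP => -[z' /andP[cz' z'e]].
by have := hdisj.2 _ _ _ _ z'e cz' ze ncz erefl; rewrite fz.
Qed.

Lemma answer_map nu : satisfies Q x y n P nu ->
  answer x y n P (map_tuple nu (in_tuple (cq_head Q))).
Proof. by move=> sat; exists nu. Qed.

End Answers.

Section RowAnswers.
Variables (sg : vocabulary) (V : finType) (Q : cq sg V) (x y : V) (n : nat).
Variables (alpha : nat -> nat -> bool) (vec : nat -> bool).
Hypothesis hdisj : constant_disjoint Q.
Hypothesis neq_xy : x != y.
Hypothesis n_gt0 : 0 < n.
Hypothesis alphaP : forall i j, alpha i j -> 0 < i <= n /\ 0 < j <= n.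
Variables (axy ay : ratom sg V).
Hypothesis axyQ : axy \in cq_rels Q.
Hypothesis x_axy : x \in tagged axy.
Hypothesis y_axy : y \in tagged axy.
Hypothesis ayQ : ay \in cq_rels Q.
Hypothesis x_ay : x \notin tagged ay.
Hypothesis y_ay : y \in tagged ay.

Lemma answer_select ax i : ax \in cq_rels Q -> x \in tagged ax -> y \notin tagged ax ->
  (exists d, answer (Q := Q) x y n
     (class_pred x y alpha vec (override (fun _ => false) i true) true) d)
  <-> product n alpha vec i.
Proof.
move=> axQ x_ax y_ax; split=> [[d [nu _ sat]]|/(productP _ alphaP)[j al ve]].
  have [H1 H2 /(_ _ axQ x_ax y_ax)] := satisfies_inv axyQ x_axy y_axy ayQ x_ay y_ay sat.
  rewrite /override; case: eqP => // Ei _; rewrite Ei in H1.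
  by apply/(productP _ alphaP); exists (val (nu y)).
have [/andP[i0 _] /andP[j0 _]] := alphaP al.
eexists; apply: answer_map; apply: (satisfies_point (p := exist _ i i0) (q := exist _ j j0)
  neq_xy n_gt0 alphaP axyQ x_axy y_axy) => //=.
by move=> *; rewrite /override eqxx.
Qed.

Hypothesis xy_atoms : forall a, a \in cq_rels Q -> x \in tagged a -> y \in tagged a.
Hypothesis y_bound : ~~ free Q y.
Variable ix : 'I_(size (cq_head Q)).
Hypothesis head_ix : tnth (in_tuple (cq_head Q)) ix = x.

Notation P := (class_pred x y alpha vec (fun _ => false) true).
Let row (d : (size (cq_head Q)).-tuple pnat) := val (tnth d ix).

Lemma row_map (nu : {ffun V -> pnat}) (d : (size (cq_head Q)).-tuple pnat) :
  map nu (cq_head Q) = d :> seq pnat -> row d = val (nu x).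
Proof.
move=> Ed.
have -> : d = map_tuple nu (in_tuple (cq_head Q)) by apply: val_inj; rewrite /= Ed.
by rewrite /row tnth_map head_ix.
Qed.

Lemma answer_product d : answer x y n P d -> product n alpha vec (row d).
Proof.
move=> [nu Ed sat]; rewrite (row_map Ed).
have [H1 H2 _] := satisfies_inv axyQ x_axy y_axy ayQ x_ay y_ay sat.
by apply/(productP _ alphaP); exists (val (nu y)).
Qed.

(** y is quantified and the other free variables are forced to 1, so the value of x determines the
    whole output tuple. *)
Lemma answer_row_inj d d' : answer x y n P d -> answer x y n P d' ->
  row d = row d' -> d = d'.
Proof.
move=> [nu Ed sat] [nu' Ed' sat']; rewrite (row_map Ed) (row_map Ed') => E.
apply: val_inj; rewrite /= -Ed -Ed'; apply/eq_in_map => z zh.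
have [->|zx] := eqVneq z x; first exact: val_inj.
have zy : z != y by apply: contraNneq y_bound => <-.
by rewrite (satisfies_other hdisj sat zh zx zy) (satisfies_other hdisj sat' zh zx zy).
Qed.

Lemma product_answer i : product n alpha vec i ->
  0 < i <= n /\ exists2 d, answer x y n P d & row d = i.
Proof.
move=> /(productP _ alphaP)[j al ve]; have [Hi /andP[j0 _]] := alphaP al; split=> //.
have i0 : 0 < i by case/andP: Hi.
pose nu : {ffun V -> pnat} := point x y (exist _ i i0) (exist _ j j0).
exists (map_tuple nu (in_tuple (cq_head Q))).
  apply: answer_map; apply: (satisfies_point neq_xy n_gt0 alphaP axyQ x_axy y_axy) => //=.
  by move=> a aQ xa; rewrite (xy_atoms aQ xa).
by rewrite (@row_map nu) // point_x.
Qed.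

End RowAnswers.

(** * From dynamic evaluation to matrix-vector multiplication *)

Lemma word_bound_monotone c N N' : N <= N' -> word_bound c N <= word_bound c N'.
Proof. by case: c => // c le; rewrite leq_mul2l leq_exp2r. Qed.

(** * Starting from the empty database *)

Section Start.
Variables (K : comNzSemiRingType) (sg : vocabulary) (V : finType).
Variables (Q : cq sg V) (A : dyn_algorithm) (c : nat).
Hypothesis hdisj : constant_disjoint Q.
Hypothesis hA : forall (D : database K sg) fs rs, lists_facts D fs ->
  let M := word_bound c (session_size D fs rs) in
  exists t m,
    [/\ halts_in M (dyn_preprocess A)
          (load (db_words D fs) [seq db_rel D f | f <- fs] (memory0 K)) t m,
        t <= c * (db_size D).+1 &
        session (Q := Q) A c M D [::] m rs].

Lemma cst_value_gt0 n e : 0 < n -> 0 < cst_value Q n e.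
Proof. by rewrite /cst_value; case: ifP. Qed.

(** The first clause of constant-disjointness keeps the constant 1 out of those set to n, as a
    database must interpret it by 1. *)
Lemma cst_value1 n : cst_value Q n (cst1 sg) = 1.
Proof.
rewrite /cst_value ifN //; apply/existsP => -[z /andP[cz ze]].
exact: hdisj.1 ze cz erefl.
Qed.

Lemma session_size_le n k (D : database K sg) rs : 0 < n ->
  (forall e, val (db_cst D e) = cst_value Q n e) ->
  size rs <= k -> all (@bounded_request K sg (word_limit sg n)) rs ->
  session_size D [::] rs <= k + word_limit sg n.
Proof.
move=> n0 Hcst rsk Brs; rewrite /session_size add0n leq_add //.
apply/bigmax_leqP_seq => w + _; rewrite mem_cat => /orP[].
  rewrite inE cats0 => /orP[/eqP->//|/mapP[e _ ->]].
  by rewrite Hcst /cst_value /word_limit; case: ifP => _; lia.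
elim: rs Brs {rsk} => //= r rs IHrs /andP[/allP Br Brs].
by rewrite mem_cat => /orP[/Br|/(IHrs Brs)].
Qed.

(** The input of the preprocessing does not depend on the requests, so determinism gives one memory
    that serves all short lists; its time is c (0 + 1) = c. *)
Lemma serves_start n k M : 0 < n ->
  word_bound c (k + word_limit sg n) <= M ->
  exists (D : database K sg) t m,
    [/\ forall e, val (db_cst D e) = cst_value Q n e, forall f, db_rel D f = 0%R,
        halts_in M (dyn_preprocess A)
          (load (db_words D [::]) [::] (memory0 K)) t m, t <= c &
        serves A c M (word_limit sg n) k D
          ([::] : seq ((size (cq_head Q)).-tuple pnat)) m].
Proof.
move=> n0 leM.
pose D : database K sg := @Database K sg [fsfun]
  (fun e => exist _ (cst_value Q n e) (cst_value_gt0 e n0)) (cst_value1 n).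
have Hl : lists_facts D [::] by split=> // f; rewrite /= finsupp0 inE.
have Hs : db_size D = 0 by rewrite /db_size /= finsupp0 cardfs0.
have leM' rs : size rs <= k -> all (@bounded_request K sg (word_limit sg n)) rs ->
    word_bound c (session_size D [::] rs) <= M.
  move=> rsk Brs; apply: leq_trans leM; apply: word_bound_monotone.
  exact: session_size_le.
have [t [m [Hh tc _]]] := hA [::] Hl.
exists D, t, m; split=> //.
- by move=> f; rewrite /= fsfun_dflt // finsupp0.
- by apply: halts_in_monotone Hh; exact: leM'.
- by move: tc; rewrite Hs muln1.
move=> rs rsk Brs; have [t' [m' [Hh' _ ses]]] := hA rs Hl.
have Em : m' = m.
  apply: (halts_in_deterministic (halts_in_monotone (leM' _ rsk Brs) Hh')).
  by apply: halts_in_monotone Hh; exact: leM'.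
by rewrite -Em; apply: session_monotone ses; exact: leM'.
Qed.

End Start.

Lemma nth_allpairs (S T U : Type) (f : S -> T -> U) (s : seq S) (t : seq T)
    i j x0 y0 z0 : i < size s -> j < size t ->
  nth z0 [seq f a b | a <- s, b <- t] (i * size t + j)
  = f (nth x0 s i) (nth y0 t j).
Proof.
move=> + jt; elim: s i => //= a s IHs [|i] lt_i; rewrite nth_cat size_map.
  by rewrite mul0n add0n jt (nth_map y0).
rewrite mulSn -addnA ltnNge leq_addr /= addKn; exact: IHs.
Qed.

(** * Boolean matrices and vectors as predicates on indices *)

Section Matrices.
Variable n : nat.

(** Indices are shifted by one because domain elements are positive, and the predicate is false off
    the matrix. *)
Definition mx_pred (B : 'M[bool]_n) (i j : nat) : bool :=
  [exists i0 : 'I_n, exists j0 : 'I_n, [&& i == i0.+1, j == j0.+1 & B i0 j0]].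

Definition vec_pred (v : 'cV[bool]_n) (j : nat) : bool :=
  [exists j0 : 'I_n, (j == j0.+1) && v j0 ord0].

Lemma mx_predP B i j : mx_pred B i j -> 0 < i <= n /\ 0 < j <= n.
Proof.
by move=> /existsP[i0 /existsP[j0 /and3P[/eqP-> /eqP-> _]]]; rewrite !ltn_ord.
Qed.

Lemma vec_predP v j : vec_pred v j -> 0 < j <= n.
Proof. by move=> /existsP[j0 /andP[/eqP-> _]]; rewrite ltn_ord. Qed.

Lemma mx_predE B (i j : 'I_n) : mx_pred B i.+1 j.+1 = B i j.
Proof.
apply/idP/idP => [/existsP[i0 /existsP[j0 /and3P[]]]|Bij].
  by rewrite !eqSS => /eqP/val_inj-> /eqP/val_inj->.
by apply/existsP; exists i; apply/existsP; exists j; rewrite !eqxx.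
Qed.

Lemma vec_predE v (j : 'I_n) : vec_pred v j.+1 = v j ord0.
Proof.
apply/idP/idP => [/existsP[j0 /andP[]]|vj].
  by rewrite eqSS => /eqP/val_inj->.
by apply/existsP; exists j; rewrite eqxx.
Qed.

Lemma product_bool_mulmx B v (i : 'I_n) :
  product n (mx_pred B) (vec_pred v) i.+1 = bool_mulmx B v i ord0.
Proof.
by rewrite mxE; apply: eq_existsb => j; rewrite mx_predE vec_predE.
Qed.

Lemma stores_matrix_load B :
  stores_matrix n (mx_pred B) (load (n :: mx_words B) [::] (memory0 nat)).
Proof.
move=> [//|i] [//|j] /= lt_i lt_j.
have n0 : 0 < n by case: (n) lt_i.
have lt_ij : i * n + j < n * n by nia.
rewrite addnS ltnS /mx_words size_allpairs size_enum_ord lt_ij /=.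
have := @nth_allpairs _ _ _ (fun i j => nat_of_bool (B i j)) (enum 'I_n) (enum 'I_n)
  i j (Ordinal n0) (Ordinal n0) 0.
rewrite size_enum_ord => -> //; rewrite -mx_predE.
by rewrite !nth_enum_ord.
Qed.

Lemma vec_words_load v m j : 0 < j <= n ->
  wmem (load (vec_words v) [::] m : memory nat) 0 j.-1 = vec_pred v j.
Proof.
case: j => // j /= lt_j; have n0 : 0 < n by case: (n) lt_j.
rewrite size_map size_enum_ord lt_j (nth_map (Ordinal n0)) ?size_enum_ord //.
by rewrite -vec_predE nth_enum_ord.
Qed.

End Matrices.

(** * The OMv algorithm and its quadratic running time *)

Section Assembly.
Variables (K : comNzSemiRingType) (sg : vocabulary) (V : finType).
Variables (Q : cq sg V) (x y : V) (A : dyn_algorithm) (c : nat).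
Hypothesis hjoins : no_self_joins Q.
Hypothesis hdisj : constant_disjoint Q.
Hypothesis hK : gen01_zero_sum_free K.
Hypothesis hA : forall (D : database K sg) fs rs, lists_facts D fs ->
  let M := word_bound c (session_size D fs rs) in
  exists t m,
    [/\ halts_in M (dyn_preprocess A)
          (load (db_words D fs) [seq db_rel D f | f <- fs] (memory0 K)) t m,
        t <= c * (db_size D).+1 &
        session (Q := Q) A c M D [::] m rs].
Hypothesis neq_xy : x != y.
Hypothesis y_atoms : class_atoms Q x y false true != [::].
Variable src : loc.
(** The two cases differ only in how a round reads off the product; this specification of the row
    phase lets them share the rest. *)
Hypothesis wp_rows : forall n M (alpha : nat -> nat -> bool) (vec : nat -> bool) k mu,
  0 < n -> word_limit sg n <= M -> n * n + n <= M ->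
  (forall i j, alpha i j -> 0 < i <= n /\ 0 < j <= n) ->
  (forall j, vec j -> 0 < j <= n) ->
  (forall i, 0 < i <= n -> wmem mu 1 i.-1 = 0) ->
  state K (Q := Q) x y A c n M (n * (size (class_atoms Q x y true false)).*2.+1 + k)
        (class_pred x y alpha vec (fun _ => false) true) [::] mu ->
  wp M (rows_cmd Q x y A src) (rows_time Q x y c n) (fun mu' =>
    (exists s, state K (Q := Q) x y A c n M k
       (class_pred x y alpha vec (fun _ => false) true) s mu') /\
    (forall i, 0 < i <= n -> wmem mu' 1 i.-1 = product n alpha vec i)) mu.

Definition round_cmd := Seq (vector_cmd Q x y A) (rows_cmd Q x y A src).

Definition omv_of_dyneval : omv_algorithm :=
  @OmvAlgorithm (compile 0 (preprocess_cmd Q x y A)) (compile 0 round_cmd)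
    (introT andP (conj (compile_plain 0 (preprocess_cmd Q x y A))
                       (compile_plain 0 round_cmd))).

Definition round_requests n :=
  n * (size (class_atoms Q x y false true)).*2 +
  n * (size (class_atoms Q x y true false)).*2.+1.

Definition round_time n := vector_time Q x y c n + rows_time Q x y c n.

(** [beta] is the vector left over from the previous round, which the next one overwrites. *)
Lemma omv_rounds_correct n M (B : 'M[bool]_n) (vs : seq 'cV[bool]_n)
    (beta : nat -> bool) seen mu :
  0 < n -> word_limit sg n <= M -> n * n + n <= M ->
  (forall j, beta j -> 0 < j <= n) ->
  state K (Q := Q) x y A c n M (size vs * round_requests n)
    (class_pred x y (mx_pred B) beta (fun _ => false) true) seen mu ->
  exists2 t, omv_rounds omv_of_dyneval M B mu vs t & t <= size vs * round_time n.
Proof.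
move=> n0 M1 M2; elim: vs beta seen mu => [|v vs IH] beta seen mu betaP st.
  by exists 0.
pose mu0 : memory nat := load (vec_words v) [::] mu.
have st0 : state K (Q := Q) x y A c n M
    (n * (size (class_atoms Q x y false true)).*2 +
     (n * (size (class_atoms Q x y true false)).*2.+1 + size vs * round_requests n))
    (class_pred x y (mx_pred B) beta (fun _ => false) true) seen mu0.
  rewrite addnA; apply: state_frame st => // b i b2.
  by rewrite /=; case: b b2.
have : wp M round_cmd (round_time n) (fun mu' =>
    (exists s, state K (Q := Q) x y A c n M (size vs * round_requests n)
       (class_pred x y (mx_pred B) (vec_pred v) (fun _ => false) true) s mu') /\
    (forall i, 0 < i <= n -> wmem mu' 1 i.-1
       = product n (mx_pred B) (vec_pred v) i)) mu0.
  apply: wp_bind (wp_vector hK hjoins neq_xy n0 M1 M2 y_atoms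
    (@vec_predP _ v) betaP _ st0) _.
    by move=> j; exact: vec_words_load.
  move=> mu1 [st1 out1].
  exact: wp_rows n0 M1 M2 (@mx_predP _ B) (@vec_predP _ v) out1 st1.
move=> /wp_halts[t1 [mu' [Hh t1le [[s st'] out]]]].
have [t2 Hr t2le] := IH _ _ _ (@vec_predP _ v) st'.
exists (t1 + t2); last by rewrite /= mulSn leq_add.
exists t1, t2, mu'; split=> // i.
by rewrite -product_bool_mulmx -(out i.+1) //=.
Qed.

Definition total_requests n :=
  size (class_atoms Q x y false false) +
  (n * (n * size (class_atoms Q x y true true)) + n * round_requests n).

Lemma omv_runs_correct n M (B : 'M[bool]_n) (vs : n.-tuple 'cV[bool]_n) :
  0 < n -> word_limit sg n <= M -> n * n + n <= M ->
  word_bound c (total_requests n + word_limit sg n) <= M ->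
  exists2 t, omv_runs omv_of_dyneval M B vs t &
             t <= preprocess_time Q x y c n + n * round_time n.
Proof.
move=> n0 M1 M2 M3.
have [D [t [m [H1 H2 H3 H4 H5]]]] := serves_start hdisj hA n0 M3.
have [|||t1 [mu [Hh t1le st]]] := wp_halts (wp_preprocess hK hjoins neq_xy n0 M1 M2
  (@mx_predP _ B) (mu := load (n :: mx_words B) [::] (memory0 nat)) H1 H2 H3 H4 H5 _ _ _).
- by [].
- by move=> [].
- exact: stores_matrix_load.
have [||t2 Hr t2le] := @omv_rounds_correct n M B vs (fun _ => false) [::] mu n0 M1 M2.
- by [].
- by rewrite size_tuple.
exists (t1 + t2); first by exists t1, t2, mu.
by rewrite leq_add //; rewrite size_tuple in t2le.
Qed.

Lemma omv_of_dyneval_quadratic : exists c' C, forall n (B : 'M[bool]_n)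
    (vs : n.-tuple 'cV[bool]_n), 0 < n ->
  exists2 t, omv_runs omv_of_dyneval (word_bound c' n) B vs t & t <= C * (n * n).
Proof.
pose z00 := size (class_atoms Q x y false false).
pose z11 := size (class_atoms Q x y true true).
pose z01 := size (class_atoms Q x y false true).
pose z10 := size (class_atoms Q x y true false).
pose E := z00 + z11 + z01.*2 + z10.*2 + #|rel sg| + 10.
(* By [NE] below, the session parameter N satisfies N + 2 <= E (n + 2)^2, hence c (N + 2)^c <= c E^c
   (n + 2)^(2 c); [c'] dominates both c E^c and 2 c. The summands E and 2 serve for the quadratic
   bound [big]. *)
pose c' := c * E ^ c + 2 * c + E + 2.
(* The time is a polynomial in n of degree at most 2 with nonnegative coefficients, so for n >= 1 it
   is at most n^2 times its value at 1. *)
pose C := preprocess_time Q x y c 1 + round_time 1.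
exists c', C => n B vs n0.
have NE : (total_requests n + word_limit sg n).+2 <= E * n.+2 ^ 2.
  rewrite /total_requests /round_requests /word_limit /E -/z00 -/z11 -/z01 -/z10.
  rewrite -!muln2; move: #|rel sg| => r; rewrite expnS expn1; nia.
have pw d : d <= c' -> n.+2 ^ d <= n.+2 ^ c' by move=> ?; rewrite leq_exp2l.
have big : E * n.+2 ^ 2 <= word_bound c' n.
  by apply: leq_mul; [rewrite /c'; lia|apply: pw; rewrite /c'; lia].
have [|||t Ht tle] := @omv_runs_correct n (word_bound c' n) B vs n0.
- by apply: leq_trans big; apply: leq_trans NE; lia.
- apply: leq_trans big; rewrite /E expnS expn1; nia.
- rewrite {1}/word_bound; apply: (@leq_trans (c * (E * n.+2 ^ 2) ^ c)).
    by rewrite leq_mul2l; case: (c) => // c0; rewrite leq_exp2r.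
  rewrite expnMn mulnA -expnM /word_bound; apply: leq_mul; first by rewrite /c'; lia.
  by apply: pw; rewrite /c'; lia.
exists t => //; apply: leq_trans tle _.
rewrite /C /preprocess_time /round_time /matrix_time /vector_time /rows_time.
move: (updates_time _ _) (updates_time _ _) (column_time _ _ _ _) (row_time _ _ _ _) (size _).
move=> u1 u2 u3 u4 u5; nia.
Qed.

End Assembly.

Lemma not_OMv_conjecture (R : realType) (B : omv_algorithm) c C :
  (forall n (X : 'M[bool]_n) (vs : n.-tuple 'cV[bool]_n), 0 < n ->
     exists2 t, omv_runs B (word_bound c n) X vs t & t <= C * (n * n)) ->
  ~ OMv_conjecture R.
Proof.
(* With eps = 1 the forbidden exponent is 3 - 1 = 2. *)
move=> H /(_ 1%R ltr01); apply; exists B, c, C%:R%R => n X vs n0.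
have [t Ht tle] := H n X vs n0; exists t; split=> //.
have -> : (3 - 1 = 2%:R :> R)%R by rewrite -(natrB _ (isT : 1 <= 3)).
by rewrite powR_mulrn ?ler0n // -natrX -natrM ler_nat -mulnn.
Qed.

(** * The two ways of not being q-hierarchical *)

Section HardQueries.
Variables (R : realType) (K : comNzSemiRingType) (sg : vocabulary) (V : finType).
Variables (Q : cq sg V) (x y : V).
Hypothesis hjoins : no_self_joins Q.
Hypothesis hdisj : constant_disjoint Q.
Hypothesis hK : gen01_zero_sum_free K.
Hypothesis hdyn : dyneval_solvable K Q.

Lemma atoms_ofP (z : V) (a : ratom sg V) :
  (a \in atoms_of Q z) = (a \in cq_rels Q) && (z \in tagged a).
Proof. by rewrite inE. Qed.

Lemma class_atoms_neq0 bx by_ (a : ratom sg V) : a \in cq_rels Q ->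
  (x \in tagged a) = bx -> (y \in tagged a) = by_ ->
  class_atoms Q x y bx by_ != [::].
Proof.
move=> aQ Ex Ey; apply/negP => /eqP E.
have : a \in class_atoms Q x y bx by_ by rewrite mem_filter Ex Ey !eqxx.
by rewrite E.
Qed.

Lemma not_hierarchical_hard ax axy ay :
  ax \in atoms_of Q x -> ax \notin atoms_of Q y ->
  axy \in atoms_of Q x -> axy \in atoms_of Q y ->
  ay \in atoms_of Q y -> ay \notin atoms_of Q x -> ~ OMv_conjecture R.
Proof.
rewrite !atoms_ofP => /andP[axQ x_ax]; rewrite axQ /= => y_ax.
move=> /andP[axyQ x_axy] /andP[_ y_axy] /andP[ayQ y_ay]; rewrite ayQ /= => x_ay.
have neq_xy : x != y by apply: contraNneq y_ax => <-.
have [A [c hA]] := hdyn.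
have y_atoms := class_atoms_neq0 ayQ (negPf x_ay) y_ay.
have x_atoms := class_atoms_neq0 axQ x_ax (negPf y_ax).
have [] := omv_of_dyneval_quadratic hjoins hdisj hK hA neq_xy y_atoms (src := Dir 2 1).
  move=> n M alpha vec k mu n0 M1 M2 alphaP vecP out0 st.
  apply: (wp_rows_select hK hjoins neq_xy n0 M1 M2 alphaP y_atoms vecP x_atoms) => // i _.
  exact: (answer_select _ neq_xy n0 alphaP axyQ x_axy y_axy ayQ x_ay y_ay _ axQ).
by move=> c' [C]; exact: not_OMv_conjecture.
Qed.

(** Since x is covered and its atoms are among those of y, some atom mentions both; strictness
    supplies an atom with y but not x, and no atom has x without y. *)
Lemma not_q_hierarchical_hard : covered Q x -> free Q x -> ~~ free Q y ->
  atoms_of Q x \proper atoms_of Q y -> ~ OMv_conjecture R.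
Proof.
move=> /set0Pn[axy xxy] fx fy /properP[/fintype.subsetP sub [ay yay nxay]].
have xy_atoms (a : ratom sg V) : a \in cq_rels Q -> x \in tagged a -> y \in tagged a.
  by move=> aQ xa; have := sub a; rewrite !atoms_ofP aQ; apply.
move: xxy yay nxay; rewrite !atoms_ofP.
move=> /andP[axyQ x_axy] /andP[ayQ y_ay]; rewrite ayQ /= => x_ay.
have y_axy := xy_atoms _ axyQ x_axy.
have neq_xy : x != y by apply: contraNneq x_ay => ->.
have [A [c hA]] := hdyn.
have y_atoms := class_atoms_neq0 ayQ (negPf x_ay) y_ay.
have x_atoms : class_atoms Q x y true false = [::].
  apply/eqP/negPn/negP; rewrite -has_filter => /hasP[a aQ /andP[/eqP xa]].
  by rewrite (xy_atoms a aQ xa).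
have lt_ix : index x (cq_head Q) < size (cq_head Q) by rewrite index_mem.
pose ix := Ordinal lt_ix.
have head_ix : tnth (in_tuple (cq_head Q)) ix = x.
  by rewrite (tnth_nth x) /= nth_index.
have [] := omv_of_dyneval_quadratic hjoins hdisj hK hA neq_xy y_atoms
  (src := Dir (wbank 1) ix.+1).
  (* As the class of atoms with x alone is empty, the budget of the row phase amounts to n demands
     for an answer. *)
  move=> n M alpha vec k mu n0 M1 M2 alphaP vecP out0; rewrite x_atoms muln1 => st.
  apply: (wp_rows_enumerate hK hjoins neq_xy n0 M1 M2 alphaP y_atoms vecP x_atoms) => //.
  - exact: (answer_product alphaP axyQ x_axy y_axy ayQ x_ay y_ay head_ix).
  - exact: (answer_row_inj hdisj fy head_ix).
  - exact: (product_answer neq_xy n0 alphaP axyQ x_axy y_axy xy_atoms head_ix).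
by move=> c' [C]; exact: not_OMv_conjecture.
Qed.

End HardQueries.

Theorem theorem14 (R : realType) (K : comNzSemiRingType) (sg : vocabulary)
    (V : finType) (Q : cq sg V)
    (hjoins : no_self_joins Q) (hdisj : constant_disjoint Q)
    (hK : gen01_zero_sum_free K)
    (hdyn : dyneval_solvable K Q) :
  OMv_conjecture R -> q_hierarchical Q.
Proof.
move=> omv x y cx cy; split; last first.
  move=> fx pr; apply/negPn/negP => fy.
  exact: not_q_hierarchical_hard hjoins hdisj hK hdyn cx fx fy pr omv.
have [sxy|/subsetPn[ax xax nyax]] := boolP (atoms_of Q x \subset atoms_of Q y).
  exact: Or31.
have [syx|/subsetPn[ay yay nxay]] := boolP (atoms_of Q y \subset atoms_of Q x).
  exact: Or32.
have [dis|] := boolP [disjoint atoms_of Q x & atoms_of Q y]; first exact: Or33.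
rewrite -finset.setI_eq0 => /set0Pn[axy]; rewrite finset.in_setI => /andP[xaxy yaxy].
by case: (not_hierarchical_hard hjoins hdisj hK hdyn xax nyax xaxy yaxy yay nxay omv).
Qed.
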